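(* Let $V$ be the $2|1$-dimensional complex $\mathbb{Z}_2$-graded vector space with basis $v_1,v_2$ (even) and $v_3$ (odd), and for $(p,q)\in\mathbb{C}^2$ let $d_{13}(p:q)=\psi^{22}_3+p\,\psi^{21}_3+q\,\psi^{12}_3$. Up to equivalence $d_{13}(p:q)$ depends only on $(p:q)$ up to nonzero scaling, and $d_{13}(p:q)\sim d_{13}(q:p)$. (i) For generic $(p:q)$, that is, $(p:q)$ different (up to interchanging the coordinates) from the special points $(1:0)$, $(1:1)$, $(1:-1)$, $(0:0)$, a miniversal deformation of $d_{13}(p:q)$ is $d^\infty=d_{13}(p+t:q)$, with base $\mathbb{C}[[t]]$, which is a smooth deformation along the family. For $(1:1)$ the same formula gives a miniversal deformation. (ii) A miniversal deformation of $d_{13}(1:0)$ is $d^\infty=d_{13}(1:0)+t\,\psi^{11}_3$, with base $\mathbb{C}[[t]]$, and it is equivalent to $d_{13}(1+\sqrt{1-4t}:2t)$. (iii) A miniversal deformation of $d_{13}(1:-1)$ is $d^\infty=d_{13}(1:-1)+t\,\psi^{11}_3$, with base $\mathbb{C}[[t]]$, and it is equivalent to $d_{13}(1+t:-1+t+\sqrt{-t})$. (iv) A miniversal deformation of $d_{13}(0:0)=\psi^{22}_3$ is $$\begin{aligned}d^\infty=\;&\psi^{22}_3+t_4\psi^{11}_3+t_3\psi^{21}_3+t_2\psi^{33}_3-t_1\psi^{23}_1+t_1t_3\psi^{31}_1+t_1\psi^{32}_1-t_2t_3\psi^{13}_2\\&+(-t_2+t_1t_3)\psi^{23}_2+(t_1t_4+t_2t_3-2t_3^2t_1)\psi^{31}_2+(t_2-2t_1t_3)\psi^{32}_2,\end{aligned}$$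 whose base is the quotient of $\mathbb{C}[[t_1,t_2,t_3,t_4]]$ by the relations $$t_1t_4-t_2t_3=0,\quad t_1(2t_3^2-t_4)=0,\quad t_1t_3=0,\quad (2t_1t_3-t_2)(t_4-t_3^2)=0,\quad t_1(t_4-t_3)=0,$$ $$t_1t_4=0,\quad t_1t_3=0,\quad t_1t_3t_4=0,\quad t_1t_4+t_2t_3-2t_1t_3^2=0.$$ The solutions of these relations are $t_3=t_4=0$ and $t_1=t_2=0$, so the base is given by two planes intersecting transversally at the origin. On the first plane $d^\infty=\psi^{22}_3+t_1(\psi^{32}_1-\psi^{23}_1)+t_2(\psi^{32}_2-\psi^{23}_2+\psi^{33}_3)$ is equivalent to $d_1=\psi^{23}_2-\psi^{32}_2+\psi^{22}_3-\psi^{33}_3$, except on the line $t_2=0$, where it jumps to $d_{12}=\psi^{22}_3+\psi^{23}_1-\psi^{32}_1$. On the second plane $d^\infty=\psi^{22}_3+t_3\psi^{21}_3+t_4\psi^{11}_3$ gives jump deformations to $d_{13}(p:q)$ for all $(p:q)$ except $(0:0)$.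
   Context: Notation: $\psi^{ij}_k:V\otimes V\to V$ is the linear map with $\psi^{ij}_k(v_a\otimes v_b)=v_k$ if $(a,b)=(i,j)$ and $0$ otherwise. A codifferential of degree 2 on $V$ is an odd linear map $d:V\otimes V\to V$ such that for all homogeneous $a,b,c$, $d(d(a,b),c)+(-1)^{|a|}d(a,d(b,c))=0$. Two codifferentials $d,d'$ are equivalent ($d\sim d'$) if $d'=g^{-1}\circ d\circ(g\otimes g)$ for some even linear automorphism $g$ of $V$. A one-parameter family of deformations $d_t$ of $d$ (with $d_0=d$) is a jump deformation from $d$ to $d'$ if $d_t$ is equivalent to $d'$ for every small $t\neq0$; it is a smooth deformation if the $d_t$ are all nonequivalent for $t$ small enough. Deformations: a formal base is a (purely even) commutative unital $\mathbb{C}$-algebra $A$ with an augmentation $A\to\mathbb{C}$ whose kernel $\mathfrak m$ is the unique maximal ideal of $A$ (so $A=\mathbb{C}\oplus\mathfrak m$), and which is complete, $A=\varprojlim_k A/\mathfrak m^k$; it is infinitesimal if $\mathfrak m^2=0$. A deformation of $d$ with base $A$ is $d_A=d+\varphi$ with $\varphi:V\otimes V\to V\otimes\mathfrak m$ odd and $d_A$ (extended $A$-linearly) satisfying the codifferential identity. Deformations $d_A,d_A'$ are equivalent ($d_A\sim d'_A$) if $d_A'=g^{-1}\circ d_A\circ(g\otimes g)$ for some $A$-linear automorphism $g=I+\lambda$ with $\lambda:V\to V\otimes\mathfrak m$ even. A morphism $f:A\to B$ of augmented algebras pushes $d_A$ forward to $f_*(d_A)=(1\otimes f)d_A$. A deformation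 $d_A$ with formal base is versal if for every deformation $d_B$ with formal base $B$ there is a morphism $f:A\to B$ with $f_*(d_A)\sim d_B$; it is miniversal if moreover $f$ is unique whenever $B$ is infinitesimal.
   Formalization: The closing equivalences of (ii) and (iii) are false as printed; they are corrected to d13(1-2t+√(1-4t):-2t) and d13(1+t:-1+t+2√(-t)), and the printed formulas are shown equivalent to the same families only after a formal change of parameter. *)

(* Defs.v *)
From HB Require Import structures.
From mathcomp Require Import all_boot all_order all_algebra.
From mathcomp Require Import generic_quotient ring_quotient.
From mathcomp Require Import boolp reals complex mpoly.

Set Implicit Arguments.
Unset Strict Implicit.
Unset Printing Implicit Defensive.

Import Order.TTheory GRing.Theory Num.Theory.

Local Open Scope ring_scope.
Local Open Scope quotient_scope.

(* A series is the family of its coefficients, indexed by exponents. *)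
Definition pseries (K : fieldType) (n : nat) : Type := 'X_{1..n} -> K.

Section PowerSeries.
Variables (K : fieldType) (n : nat).
Local Notation S := (pseries K n).
Implicit Types f g h : S.

HB.instance Definition _ := gen_eqMixin S.
HB.instance Definition _ := gen_choiceMixin S.

Definition ps_add f g : S := fun m => f m + g m.
Definition ps_opp f : S := fun m => - f m.
Definition ps_zero : S := fun=> 0.
Definition ps_one : S := fun m => (m == 0%MM)%:R.
Definition ps_scale (c : K) f : S := fun m => c * f m.
Definition ps_mul f g : S := fun m =>
  \sum_(k : 'X_{1..n < (mdeg m).+1, (mdeg m).+1} | m == (k.1 + k.2)%MM)
    f k.1 * g k.2.

Fact ps_addA : associative ps_add.
Proof. by move=> f g h; apply/funext => m; rewrite /ps_add addrA. Qed.
Fact ps_addC : commutative ps_add.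
Proof. by move=> f g; apply/funext => m; rewrite /ps_add addrC. Qed.
Fact ps_add0 : left_id ps_zero ps_add.
Proof. by move=> f; apply/funext => m; rewrite /ps_add add0r. Qed.
Fact ps_addN : left_inverse ps_zero ps_opp ps_add.
Proof. by move=> f; apply/funext => m; rewrite /ps_add addNr. Qed.

HB.instance Definition _ :=
  GRing.isZmodule.Build S ps_addA ps_addC ps_add0 ps_addN.

(* The ring laws hold coefficientwise, where they are those of truncations. *)
Definition ps_trunc d f : {mpoly K[n]} :=
  \sum_(k : 'X_{1..n < d}) f k *: 'X_[k].

Fact ps_truncE d f m : (mdeg m < d)%N -> (ps_trunc d f)@_m = f m.
Proof. by move=> md; rewrite /ps_trunc mcoeff_mpoly. Qed.

Fact ps_mulE d f g m : (mdeg m < d)%N ->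
  ps_mul f g m = (ps_trunc d f * ps_trunc d g)@_m.
Proof.
move=> md; rewrite mcoeffM; apply: eq_bigr => k _.
by rewrite !ps_truncE //; apply: leq_trans (bmdeg _) md.
Qed.

Fact ps_mulE2 d p g f m : (mdeg m < d)%N ->
  (forall k, (mdeg k < d)%N -> p@_k = f k) ->
  ps_mul f g m = (p * ps_trunc d g)@_m.
Proof.
move=> md pf; rewrite mcoeffM; apply: eq_bigr => k _.
by rewrite pf ?ps_truncE //; apply: leq_trans (bmdeg _) md.
Qed.

Fact ps_mulC : commutative ps_mul.
Proof.
by move=> f g; apply/funext => m; rewrite !(ps_mulE _ _ (ltnSn _)) mulrC.
Qed.

Fact ps_mulA : associative ps_mul.
Proof.
move=> f g h; apply/funext => m; set d := (mdeg m).+1.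
have md : (mdeg m < d)%N by [].
rewrite (@ps_mulE2 d (ps_trunc d f * ps_trunc d g) h) //; last first.
  by move=> k kd; rewrite (ps_mulE f g kd).
rewrite ps_mulC (@ps_mulE2 d (ps_trunc d g * ps_trunc d h) f) //; last first.
  by move=> k kd; rewrite (ps_mulE g h kd).
by rewrite mulrC mulrA.
Qed.

Fact ps_mul1 : left_id ps_one ps_mul.
Proof.
move=> f; apply/funext => m; have md := ltnSn (mdeg m).
rewrite (@ps_mulE2 _ 1 f ps_one m md) ?mul1r ?ps_truncE //.
by move=> k _; rewrite mcoeff1.
Qed.

Fact ps_mulDl : left_distributive ps_mul +%R.
Proof.
move=> f g h; apply/funext => m.
rewrite /ps_mul -[RHS]/(_ + _) -big_split /=.
by apply: eq_bigr => k _; rewrite -mulrDl.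
Qed.

Fact ps_one_neq0 : ps_one != 0.
Proof.
apply/eqP => /(congr1 (fun f => f 0%MM)); rewrite /ps_one eqxx.
by move/eqP; rewrite oner_eq0.
Qed.

HB.instance Definition _ := GRing.Zmodule_isComNzRing.Build S
  ps_mulA ps_mulC ps_mul1 ps_mulDl ps_one_neq0.

Fact ps_scaleA a b f : ps_scale a (ps_scale b f) = ps_scale (a * b) f.
Proof. by apply/funext => m; rewrite /ps_scale mulrA. Qed.
Fact ps_scale1 : left_id 1 ps_scale.
Proof. by move=> f; apply/funext => m; rewrite /ps_scale mul1r. Qed.
Fact ps_scaleDr : right_distributive ps_scale +%R.
Proof. by move=> c f g; apply/funext => m; rewrite /ps_scale mulrDr. Qed.
Fact ps_scaleDl f : {morph ps_scale^~ f : a b / a + b}.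
Proof. by move=> a b; apply/funext => m; rewrite /ps_scale mulrDl. Qed.

HB.instance Definition _ := GRing.Zmodule_isLmodule.Build K S
  ps_scaleA ps_scale1 ps_scaleDr ps_scaleDl.

Fact ps_scaleAl (c : K) f g : c *: (f * g) = c *: f * g.
Proof.
apply/funext => m; rewrite -[LHS]/(c * ps_mul f g m) -[RHS]/(ps_mul _ _ m).
by rewrite /ps_mul mulr_sumr; apply: eq_bigr => k _; rewrite mulrA.
Qed.

HB.instance Definition _ := GRing.Lmodule_isLalgebra.Build K S ps_scaleAl.
HB.instance Definition _ := GRing.Lalgebra_isComAlgebra.Build K S.

Definition psvar (i : 'I_n) : S := fun m => (m == U_(i)%MM)%:R.

Definition ps_const f : K := f 0%MM.

Fact ps_const_zmod : zmod_morphism ps_const. Proof. by []. Qed.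
HB.instance Definition _ :=
  GRing.isZmodMorphism.Build S K ps_const ps_const_zmod.

Fact ps_const_monoid : monoid_morphism ps_const.
Proof.
split=> [|f g]; first by rewrite /ps_const -[LHS]/(ps_one _) /ps_one eqxx.
rewrite /ps_const -[LHS]/(ps_mul f g 0%MM) (@ps_mulE 1) ?mdeg0 //.
by rewrite (mcoeff0_is_multiplicative n K).1 !ps_truncE ?mdeg0.
Qed.
HB.instance Definition _ :=
  GRing.isMonoidMorphism.Build S K ps_const ps_const_monoid.

Fact ps_const_scalable : scalable_for *%R ps_const. Proof. by []. Qed.
HB.instance Definition _ :=
  GRing.isScalable.Build K S K *%R ps_const ps_const_scalable.

Definition ps_aug : {lrmorphism S -> K | *%R} := ps_const.

End PowerSeries.

Section AlgebraQuotient.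
Variables (K : fieldType) (A : comAlgType K) (I : idealr A).
Local Notation Q := {ideal_quot I}.

Definition iq_scale (c : K) (x : Q) : Q := \pi_Q (c *: repr x).

Fact pi_iq_scale c (a : A) : iq_scale c (\pi_Q a) = \pi_Q (c *: a).
Proof.
apply/eqP; rewrite /iq_scale -Quotient.idealrBE -scalerBr -mulr_algl.
by rewrite idealMr // Quotient.idealrBE reprK.
Qed.

Fact iq_scaleA a b x : iq_scale a (iq_scale b x) = iq_scale (a * b) x.
Proof. by elim/quotW: x => x; rewrite (pi_iq_scale b) !pi_iq_scale scalerA. Qed.
Fact iq_scale1 : left_id 1 iq_scale.
Proof. by move=> x; rewrite /iq_scale scale1r reprK. Qed.
Fact iq_scaleDr : right_distributive iq_scale +%R.
Proof.
move=> c; elim/quotW=> x; elim/quotW=> y.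
by rewrite !pi_iq_scale -!rmorphD /= pi_iq_scale scalerDr.
Qed.
Fact iq_scaleDl x : {morph iq_scale^~ x : a b / a + b}.
Proof.
by move=> a b; elim/quotW: x => x; rewrite !pi_iq_scale -rmorphD /= scalerDl.
Qed.

HB.instance Definition _ := GRing.Zmodule_isLmodule.Build K Q
  iq_scaleA iq_scale1 iq_scaleDr iq_scaleDl.

Fact iq_scaleAl (c : K) (x y : Q) : c *: (x * y) = c *: x * y.
Proof.
elim/quotW: x => x; elim/quotW: y => y.
rewrite -[LHS]/(iq_scale _ _) -[c *: _]/(iq_scale _ _) -rmorphM /=.
by rewrite !pi_iq_scale -rmorphM /= scalerAl.
Qed.

HB.instance Definition _ := GRing.Lmodule_isLalgebra.Build K Q iq_scaleAl.
HB.instance Definition _ := GRing.Lalgebra_isComAlgebra.Build K Q.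

End AlgebraQuotient.

Section FormalBase.
Variables (K : fieldType) (A : comAlgType K).

Definition is_ideal (I : A -> Prop) : Prop :=
  [/\ I 0, forall x y, I x -> I y -> I (x + y) & forall a x, I x -> I (a * x)].

Definition is_maximal_ideal (I : A -> Prop) : Prop :=
  [/\ is_ideal I, ~ I 1 &
      forall J, is_ideal J -> ~ J 1 -> (forall x, I x -> J x) ->
        forall x, J x -> I x].

Fixpoint ideal_pow (I : A -> Prop) (k : nat) (x : A) : Prop :=
  if k is k'.+1 then
    exists (r : nat) (a b : 'I_r -> A),
      [/\ forall i, I (a i), forall i, ideal_pow I k' (b i) &
          x = \sum_(i < r) a i * b i]
  else True.

(* The canonical map from A to the inverse limit of the A / I^k is injective
   and surjective. *)
Definition is_complete (I : A -> Prop) : Prop :=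
  (forall x, (forall k, ideal_pow I k x) -> x = 0) /\
  (forall x : nat -> A, (forall k, ideal_pow I k (x k.+1 - x k)) ->
    exists y, forall k, ideal_pow I k (y - x k)).

Definition aug_ideal (eps : {lrmorphism A -> K | *%R}) (x : A) : Prop :=
  eps x = 0.

Definition formal_base (eps : {lrmorphism A -> K | *%R}) : Prop :=
  [/\ is_maximal_ideal (aug_ideal eps),
      forall J, is_maximal_ideal J -> forall x, J x <-> aug_ideal eps x &
      is_complete (aug_ideal eps)].

Definition infinitesimal (eps : {lrmorphism A -> K | *%R}) : Prop :=
  forall x, ideal_pow (aug_ideal eps) 2 x -> x = 0.

End FormalBase.

(* The basis vector v_(i+1) of V is the row delta_mx 0 i; v_3 is odd. *)
Definition par (i : 'I_3) : bool := i == 2 :> nat.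

(* Linear maps V (x) V -> V (x) A, given by the images of the v_i (x) v_j. *)
Notation cochain A := {ffun 'I_3 * 'I_3 -> 'rV[A]_3}.

Section Codifferentials.
Variable A : comNzRingType.
Implicit Types (d : cochain A) (x y z : 'rV[A]_3).

(* psi i j k maps v_i (x) v_j to v_k, with indices 1, 2, 3. *)
Definition psi (i j k : nat) : cochain A :=
  [ffun ab : 'I_3 * 'I_3 =>
    \row_c [&& ab.1.+1 == i, ab.2.+1 == j & c.+1 == k]%:R].

(* The A-bilinear extension of d to V (x) A, whose elements are the rows. *)
Definition ext d x y : 'rV[A]_3 :=
  \sum_(i < 3) \sum_(j < 3) (x 0 i * y 0 j) *: d (i, j).

Definition homogeneous (a : bool) x : Prop :=
  forall i, par i != a -> x 0 i = 0.

Definition odd_cochain d : Prop :=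
  forall i j, homogeneous (~~ (par i (+) par j)) (d (i, j)).

Definition codifferential d : Prop :=
  odd_cochain d /\
  forall (a b c : bool) x y z,
    homogeneous a x -> homogeneous b y -> homogeneous c z ->
    ext d (ext d x y) z + (-1) ^+ a *: ext d x (ext d y z) = 0.

(* Matrices act on rows on the right, so g is the map x |-> x *m g. *)
Definition even_mx (g : 'M[A]_3) : Prop :=
  forall i j, par i != par j -> g i j = 0.

Definition conjugate_by (g : 'M[A]_3) d d' : Prop :=
  exists h : 'M[A]_3,
    [/\ g *m h = 1%:M, h *m g = 1%:M &
        forall x y, ext d' x y = ext d (x *m g) (y *m g) *m h].

Definition equivalent d d' : Prop :=
  exists g : 'M[A]_3, even_mx g /\ conjugate_by g d d'.

Definition d13 (p q : A) : cochain A :=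
  psi 2 2 3 + p *: psi 2 1 3 + q *: psi 1 2 3.

Definition d1 : cochain A := psi 2 3 2 - psi 3 2 2 + psi 2 2 3 - psi 3 3 3.

Definition d12 : cochain A := psi 2 2 3 + psi 2 3 1 - psi 3 2 1.

Definition d13_00_inf (t1 t2 t3 t4 : A) : cochain A :=
  psi 2 2 3 + t4 *: psi 1 1 3 + t3 *: psi 2 1 3 + t2 *: psi 3 3 3
  - t1 *: psi 2 3 1 + (t1 * t3) *: psi 3 1 1 + t1 *: psi 3 2 1
  - (t2 * t3) *: psi 1 3 2 + (- t2 + t1 * t3) *: psi 2 3 2
  + (t1 * t4 + t2 * t3 - 2 * t3 ^+ 2 * t1) *: psi 3 1 2
  + (t2 - 2 * t1 * t3) *: psi 3 2 2.

Definition d13_00_rels (t1 t2 t3 t4 : A) : seq A :=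
  [:: t1 * t4 - t2 * t3;
      t1 * (2 * t3 ^+ 2 - t4);
      t1 * t3;
      (2 * t1 * t3 - t2) * (t4 - t3 ^+ 2);
      t1 * (t4 - t3);
      t1 * t4;
      t1 * t3;
      t1 * t3 * t4;
      t1 * t4 + t2 * t3 - 2 * t1 * t3 ^+ 2].

Definition ideal_gen (s : seq A) : {pred A} := fun f =>
  `[< exists c : 'I_(size s) -> A, f = \sum_(i < size s) c i * s`_i >].

End Codifferentials.

Arguments psi {A}.
Arguments d1 {A}.
Arguments d12 {A}.

Section Base.
Variable K : fieldType.
Local Notation S := (pseries K 4).

Definition d13_00_ideal : {pred S} :=
  ideal_gen (d13_00_rels (psvar K 0) (psvar K 1) (psvar K 2) (psvar K 3)).

Fact psvar_const n (i : 'I_n) : ps_const (psvar K i) = 0.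
Proof.
rewrite /ps_const /psvar; case: eqP => // /esym/eqP.
by rewrite mnm1_eq0.
Qed.

Fact d13_00_ideal_const f : f \in d13_00_ideal -> ps_const f = 0.
Proof.
move/asboolP => -[c ->]; rewrite rmorph_sum big1 //= => i _.
rewrite rmorphM /=; set s := d13_00_rels _ _ _ _.
have /allP s0 : all (fun r => ps_const r == 0) s.
  by rewrite /s /= !(rmorphB, rmorphD, rmorphM) /= !psvar_const
     !(mul0r, mulr0, subr0, oppr0, addr0) eqxx.
have si : (i < size s)%N := ltn_ord i.
by rewrite (eqP (s0 _ (mem_nth 0 si))) mulr0.
Qed.

Fact d13_00_ideal_closed : idealr_closed d13_00_ideal.
Proof.
split.
- by apply/asboolP; exists (fun=> 0); rewrite big1 // => i _; rewrite mul0r.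
- by apply/negP => /d13_00_ideal_const /eqP; rewrite rmorph1 oner_eq0.
move=> a u v /asboolP[c ->] /asboolP[e ->]; apply/asboolP.
exists (fun i => a * c i + e i); rewrite mulr_sumr -big_split /=.
by apply: eq_bigr => i _; rewrite mulrDl mulrA.
Qed.

HB.instance Definition _ := isIdealr.Build S d13_00_ideal d13_00_ideal_closed.

Definition d13_00_base : comAlgType K := {ideal_quot d13_00_ideal}.

Definition d13_00_var (i : 'I_4) : d13_00_base :=
  \pi_{ideal_quot d13_00_ideal} (psvar K i).

Definition d13_00_aug (x : d13_00_base) : K := ps_const (repr x).

Fact d13_00_augE (f : S) :
  d13_00_aug (\pi_{ideal_quot d13_00_ideal} f) = ps_const f.
Proof.
apply/eqP; rewrite -subr_eq0 -rmorphB; apply/eqP/d13_00_ideal_const.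
by rewrite Quotient.idealrBE reprK.
Qed.

Fact d13_00_aug_zmod : zmod_morphism d13_00_aug.
Proof.
elim/quotW=> f; elim/quotW=> g.
by rewrite -rmorphB /= !d13_00_augE rmorphB.
Qed.
HB.instance Definition _ :=
  GRing.isZmodMorphism.Build d13_00_base K d13_00_aug d13_00_aug_zmod.

Fact d13_00_aug_monoid : monoid_morphism d13_00_aug.
Proof.
split; first by rewrite -(rmorph1 \pi_{ideal_quot d13_00_ideal}) /=
  d13_00_augE rmorph1.
elim/quotW=> f; elim/quotW=> g.
by rewrite -rmorphM /= !d13_00_augE rmorphM.
Qed.
HB.instance Definition _ :=
  GRing.isMonoidMorphism.Build d13_00_base K d13_00_aug d13_00_aug_monoid.

Fact d13_00_aug_scalable : scalable_for *%R d13_00_aug.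
Proof.
move=> c; elim/quotW=> f; rewrite -[_ *: _]/(iq_scale _ _) pi_iq_scale.
by rewrite !d13_00_augE linearZ.
Qed.
HB.instance Definition _ :=
  GRing.isScalable.Build K d13_00_base K *%R d13_00_aug d13_00_aug_scalable.

Definition d13_00_eps : {lrmorphism d13_00_base -> K | *%R} := d13_00_aug.

End Base.

Arguments d13_00_ideal K : clear implicits.

Definition cochain_map (A B : comNzRingType) (f : A -> B) (d : cochain A) :
  cochain B := [ffun ij => map_mx f (d ij)].

Section Deformations.
Variables (K : fieldType) (d : cochain K).

Definition deformation (A : comAlgType K) (eps : {lrmorphism A -> K | *%R})
    (dA : cochain A) : Prop :=
  codifferential dA /\
  exists phi : cochain A,
    [/\ odd_cochain phi, forall ij k, aug_ideal eps (phi ij 0 k) &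
        dA = cochain_map (in_alg A) d + phi].

Definition equivalent_deformations (A : comAlgType K)
    (eps : {lrmorphism A -> K | *%R}) (dA dA' : cochain A) : Prop :=
  exists lam : 'M[A]_3,
    [/\ even_mx lam, forall i j, aug_ideal eps (lam i j) &
        conjugate_by (1%:M + lam) dA dA'].

(* f is a morphism of augmented algebras with f_* dA equivalent to dB. *)
Definition induces (A B : comAlgType K) (epsA : {lrmorphism A -> K | *%R})
    (epsB : {lrmorphism B -> K | *%R}) (f : {lrmorphism A -> B})
    (dA : cochain A) (dB : cochain B) : Prop :=
  (forall a, epsB (f a) = epsA a) /\
  equivalent_deformations epsB (cochain_map f dA) dB.

Definition versal (A : comAlgType K) (epsA : {lrmorphism A -> K | *%R})
    (dA : cochain A) : Prop :=
  [/\ formal_base epsA, deformation epsA dA &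
      forall (B : comAlgType K) (epsB : {lrmorphism B -> K | *%R})
        (dB : cochain B),
        formal_base epsB -> deformation epsB dB ->
        exists f : {lrmorphism A -> B}, induces epsA epsB f dA dB].

Definition miniversal (A : comAlgType K) (epsA : {lrmorphism A -> K | *%R})
    (dA : cochain A) : Prop :=
  versal epsA dA /\
  forall (B : comAlgType K) (epsB : {lrmorphism B -> K | *%R})
    (dB : cochain B),
    formal_base epsB -> infinitesimal epsB -> deformation epsB dB ->
    forall f g : {lrmorphism A -> B},
      induces epsA epsB f dA dB -> induces epsA epsB g dA dB -> f =1 g.

End Deformations.

Section Families.
Variables (K : numFieldType) (d : cochain K).

(* All the families considered are polynomial in the parameter. *)
Definition family (dt : K -> cochain K) : Prop :=
  [/\ dt 0 = d, forall t, codifferential (dt t) &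
      exists P : cochain {poly K},
        forall t, dt t = cochain_map (horner^~ t) P].

Definition jump_deformation (dt : K -> cochain K) (d' : cochain K) : Prop :=
  family dt /\
  exists2 e : K, 0 < e &
    forall t, t != 0 -> `|t| < e -> equivalent (dt t) d'.

Definition smooth_deformation (dt : K -> cochain K) : Prop :=
  family dt /\
  exists2 e : K, 0 < e &
    forall s t, `|s| < e -> `|t| < e -> s != t -> ~ equivalent (dt s) (dt t).

End Families.

(* Equality of (p : q) and (p' : q'), for (0 : 0) too. *)
Definition same_point (K : fieldType) (x y : K * K) : Prop :=
  exists2 c : K, c != 0 & y = (c * x.1, c * x.2).

Definition generic (K : fieldType) (p q : K) : Prop :=
  forall x, x \in [:: (1, 0); (1, 1); (1, -1); (0, 0)] ->
    ~ same_point (p, q) x /\ ~ same_point (q, p) x.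

(* A coordinate of K[[t]]: a series of order exactly 1. *)
Definition coordinate (K : fieldType) (w : pseries K 1) : Prop :=
  w 0%MM = 0 /\ w U_(ord0)%MM != 0.

(* Main.v *)
(** An odd [d] consists of a bilinear form [a] on the even plane (the products
    [v_i v_j] in the line of [v_3]), the products of [v_3] with [v_1], [v_2] on
    either side, and the square of [v_3].  When [a] has the invertible entry
    [a22], the codifferential identity expresses all the products involving
    [v_3] through [d(v_2, v_3)], and makes [a12 - a21] and [a12^2 - a11 a22]
    annihilate the latter.  Hence deformations of [d13(p:q)] with [(p:q)] other
    than [(0:0)] are deformations of the form [a] alone, up to congruence and
    scaling, and [v_1 |-> s (v_1 + x v_2)], [v_3 |-> a22 v_3] brings the form
    to the family of the theorem; finding [x] needs at most a root of a
    quadratic equation, which completeness of the base provides.  For [(0:0)]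
    the same change of basis with [s = 1] makes [a12 = 0], after which the
    codifferential identity says exactly [t1 t3 = t1 t4 = t2 t3 = t2 t4 = 0];
    these monomials generate the ideal of the relations.  A morphism to an
    infinitesimal base is determined by the images of the parameters, and
    equivalent deformations over such a base differ by a coboundary, which the
    chosen families detect. *)

Require Import Defs.
From HB Require Import structures.
From mathcomp Require Import all_boot all_order all_algebra.
From mathcomp Require Import generic_quotient ring_quotient.
From mathcomp Require Import boolp reals complex mpoly.
From mathcomp Require Import ring.
Import Order.TTheory GRing.Theory Num.Theory.

Set Implicit Arguments.
Unset Strict Implicit.
Unset Printing Implicit Defensive.

Local Open Scope ring_scope.

(** * Complete augmented algebras *)

(** A congruence by a matrix of determinant D, with v_3 multiplied by k, multiplies the alternating
    part [a12 - a21] by D/k and the determinant [a11 a22 - a12 a21] by its square. The ratio of the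
    determinant to the square of the alternating part is therefore an invariant. It separates the
    members of the smooth family, and it dictates the changes of coordinate in the two families with
    square roots: a given pair of series (p:q) has invariant -pq/(p-q)^2, which is compared with
    that of the form containing the parameter. For (0:0) the obstacle is the base. A quotient of a
    power series ring is separated only if the ideal is closed, and the list of relations does not
    show this. The ideal is the intersection of two ideals generated by variables, and membership in
    these is a condition on single coefficients, hence passes to limits. Morphisms out of power
    series are not assumed continuous; their uniqueness comes from dividing a series by the
    variables again and again. Inverses are kept out of the computations: the conjugation equation
    is multiplied by the matrix, so that the remaining identities are polynomial. *)

Section IdealPowers.
Variables (K : fieldType) (A : comAlgType K) (I : A -> Prop).
Hypothesis idI : is_ideal I.

Lemma ideal_pow_ideal k : is_ideal (ideal_pow I k).
Proof.
case: k => [|k]; first by split.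
case: idI => I0 ID IM; split => /=.
- by exists 0%N, (fun=> 0), (fun=> 0); split; [case|case|rewrite big_ord0].
- move=> _ _ [r [a [b [Ia Ib ->]]]] [s [c [d [Ic Id ->]]]].
  exists (r + s)%N, (fun i => match split i with inl j => a j | inr j => c j end),
    (fun i => match split i with inl j => b j | inr j => d j end).
  split; [by move=> i; case: split | by move=> i; case: split |].
  rewrite big_split_ord /=; congr (_ + _); apply: eq_bigr => i _.
    by rewrite (unsplitK (inl i)).
  by rewrite (unsplitK (inr i)).
- move=> x _ [r [a [b [Ia Ib ->]]]]; exists r, (fun i => x * a i), b; split=> //.
    by move=> i; apply: IM.
  by rewrite mulr_sumr; apply: eq_bigr => i _; rewrite mulrA.
Qed.

Lemma ideal_powD k x y : ideal_pow I k x -> ideal_pow I k y -> ideal_pow I k (x + y).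
Proof. by case: (ideal_pow_ideal k) => _ + _; apply. Qed.

Lemma ideal_powMl k x y : ideal_pow I k y -> ideal_pow I k (x * y).
Proof. by case: (ideal_pow_ideal k) => _ _; apply. Qed.

Lemma ideal_powMr k x y : ideal_pow I k x -> ideal_pow I k (x * y).
Proof. by rewrite mulrC; apply: ideal_powMl. Qed.

Lemma ideal_pow_0 k : ideal_pow I k 0.
Proof. by case: (ideal_pow_ideal k). Qed.

Lemma ideal_powN k x : ideal_pow I k x -> ideal_pow I k (- x).
Proof. by rewrite -mulN1r; apply: ideal_powMl. Qed.

Lemma ideal_powB k x y : ideal_pow I k x -> ideal_pow I k y -> ideal_pow I k (x - y).
Proof. by move=> Ix Iy; apply: ideal_powD => //; apply: ideal_powN. Qed.

Lemma ideal_pow_sum k (J : Type) (r : seq J) (P : pred J) (F : J -> A) :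
  (forall j, P j -> ideal_pow I k (F j)) -> ideal_pow I k (\sum_(j <- r | P j) F j).
Proof.
move=> FI; elim/big_ind: _ => [|u v|//]; first exact: ideal_pow_0.
exact: ideal_powD.
Qed.

Lemma ideal_pow_mulS k x y : I x -> ideal_pow I k y -> ideal_pow I k.+1 (x * y).
Proof.
by move=> Ix Iy; exists 1%N, (fun=> x), (fun=> y); rewrite big_ord1; split.
Qed.

Lemma ideal_pow_le j k x : (j <= k)%N -> ideal_pow I k x -> ideal_pow I j x.
Proof.
elim: k j x => [|k IH] [|j] x //=.
move=> jk [r [a [b [Ia Ib ->]]]]; apply: (@ideal_pow_sum j.+1) => i _.
by apply: ideal_pow_mulS => //; apply: IH.
Qed.

Lemma ideal_pow1 x : ideal_pow I 1 x <-> I x.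
Proof.
split=> [[r [a [b [Ia _ ->]]]]|Ix].
  case: idI => I0 ID IM; elim/big_ind: _ => [//|u v|i _]; first exact: ID.
  by rewrite mulrC; apply: IM.
by rewrite -[x]mulr1; apply: ideal_pow_mulS.
Qed.

Lemma ideal_powM j k x y :
  ideal_pow I j x -> ideal_pow I k y -> ideal_pow I (j + k) (x * y).
Proof.
elim: j x => [|j IH] x; first by move=> _; apply: ideal_powMl.
move=> [r [a [b [Ia Ib ->]]]] Iy; rewrite mulr_suml.
apply: ideal_pow_sum => i _; rewrite -mulrA addSn.
exact: ideal_pow_mulS (Ia i) (IH _ (Ib i) Iy).
Qed.

Lemma ideal_powX k x : I x -> ideal_pow I k (x ^+ k).
Proof.
by move=> Ix; elim: k => [//|k IH]; rewrite exprS; apply: ideal_pow_mulS.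
Qed.

Lemma ideal_pow_shift (x : nat -> A) :
  (forall k, ideal_pow I k (x k.+1 - x k)) ->
  forall j k, ideal_pow I k (x (j + k)%N - x k).
Proof.
move=> dx j k; elim: j => [|j IH]; first by rewrite add0n subrr; exact: ideal_pow_0.
rewrite addSn -(subrKA (x (j + k)%N)); apply: ideal_powD => //.
by apply: ideal_pow_le (dx _); apply: leq_addl.
Qed.

End IdealPowers.

Section CompleteAugmented.
Variables (K : fieldType) (A : comAlgType K) (eps : {lrmorphism A -> K | *%R}).
Local Notation m := (aug_ideal eps).

Lemma aug_ideal_ideal : is_ideal m.
Proof.
rewrite /aug_ideal; split; first exact: rmorph0.
  by move=> x y mx my; rewrite rmorphD /= mx my addr0.
by move=> a x mx; rewrite rmorphM /= mx mulr0.
Qed.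
Local Notation mI := aug_ideal_ideal.

Lemma aug_scale (c : K) : eps c%:A = c.
Proof. by rewrite linearZ /= rmorph1 mulr1. Qed.

Lemma aug_idealB x : m (x - (eps x)%:A).
Proof. by rewrite /aug_ideal rmorphB /= aug_scale subrr. Qed.

Hypothesis cA : is_complete m.

Lemma complete_separated x y : (forall k, ideal_pow m k (x - y)) -> x = y.
Proof. by move/(proj1 cA)/eqP; rewrite subr_eq0 => /eqP. Qed.

(** The inverse is the limit of the partial geometric sums, whose defect at stage [k] is
    [h ^+ k]. *)
Lemma complete_inv1B h : m h -> exists y, y * (1 - h) = 1.
Proof.
move=> mh; case: (proj2 cA (fun k => \sum_(j < k) h ^+ j)) => [k|y yP].
  by rewrite big_ord_recr addrC addKr; apply: ideal_powX.
exists y; apply: complete_separated => k.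
have -> : y * (1 - h) - 1 = (y - \sum_(j < k) h ^+ j) * (1 - h) - h ^+ k.
  rewrite mulrBl [X in _ - X - _]mulrC.
  have := subrX1 h k => e; have -> : (1 - h) * (\sum_(i < k) h ^+ i) = 1 - h ^+ k.
    by rewrite -opprB mulNr -e opprB.
  by ring.
apply: ideal_powB; first exact: mI.
  by apply: ideal_powMr; [exact: mI | exact: yP].
by apply: ideal_powX.
Qed.

Lemma complete_inv x : eps x != 0 -> exists y, y * x = 1.
Proof.
move=> ex; pose h := 1 - (eps x)^-1 *: x.
case: (@complete_inv1B h) => [|y].
  by rewrite /aug_ideal rmorphB rmorph1 /= linearZ /= mulVf // subrr.
by rewrite opprB addrC subrK -scalerAr scalerAl; exists ((eps x)^-1 *: y).
Qed.

(** Elements outside the kernel are invertible, so every proper ideal lies in the kernel. Hence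
    completeness is all that has to be checked for a base. *)
Lemma complete_formal_base : formal_base eps.
Proof.
have m1 : ~ m 1 by rewrite /aug_ideal rmorph1; apply/eqP; rewrite oner_eq0.
have maxm : is_maximal_ideal m.
  split=> [|//|J [J0 JD JM] J1 mJ x Jx]; first exact: mI.
  apply: contrapT => /eqP ex; apply: J1.
  by case: (complete_inv ex) => y <-; apply: JM.
split=> // J [[J0 JD JM] J1 maxJ].
have Jm x : J x -> m x.
  move=> Jx; apply: contrapT => /eqP ex; apply: J1.
  by case: (complete_inv ex) => y <-; apply: JM.
by move=> x; split; [exact: Jm | apply: maxJ => //; exact: mI].
Qed.

(* The iteration x_(k+1) = - s^-1 (c + a x_k^2) contracts. *)
Lemma complete_quadratic a s c : eps s != 0 -> m c ->
  exists2 x, m x & c + s * x + a * x ^+ 2 = 0.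
Proof.
move=> es mc; case: (complete_inv es) => s' s's.
pose X := fix X k := if k is k'.+1 then - s' * (c + a * X k' ^+ 2) else 0.
have mX k : m (X k).
  case: mI => m0 mD mM; case: k => [//|k] /=; elim: k => [|k IH].
    by rewrite expr0n mulr0 addr0; apply: mM.
  by apply: (mM); apply: mD => //; rewrite expr2 mulrA; apply: mM.
have dX k : ideal_pow m k (X k.+1 - X k).
  elim: k => [//|k IH].
  have -> : X k.+2 - X k.+1 = - s' * a * ((X k.+1 + X k) * (X k.+1 - X k)).
    transitivity (- s' * (c + a * X k.+1 ^+ 2) - (- s' * (c + a * X k ^+ 2))).
      by [].
    by ring.
  apply: ideal_powMl; first exact: mI.
  apply: ideal_pow_mulS IH.
  by case: mI => _ mD _; apply: mD.
case: (proj2 cA X dX) => x xX.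
have mx : m x.
  rewrite -(subrK (X 1%N) x); case: mI => _ mD _.
  by apply: mD (mX _); apply/(ideal_pow1 mI)/xX.
exists x => //; apply: complete_separated => k.
rewrite subr0.
(* The first term is small because [x] is close to [X k]; the second is one step of the iteration,
   multiplied by [s]. *)
have -> : c + s * x + a * x ^+ 2 =
  (s + a * (x + X k)) * (x - X k) + s * (X k - X k.+1).
  have -> : s * (X k - X k.+1) = s * X k + (s' * s) * (c + a * X k ^+ 2).
    by rewrite [X k.+1]/=; ring.
  by rewrite s's; ring.
apply: ideal_powD; [exact: mI | by apply: ideal_powMl; first exact: mI |].
apply: ideal_powMl; first exact: mI.
by rewrite -opprB; apply: ideal_powN => //; exact: mI.
Qed.

End CompleteAugmented.

(** * Power series *)

Lemma lrmorphism_of (K : fieldType) (A B : comAlgType K) (f : A -> B) :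
  zmod_morphism f -> monoid_morphism f -> scalable f ->
  exists F : {lrmorphism A -> B}, F =1 f.
Proof.
move=> fZ fM fS.
pose F : {lrmorphism A -> B} := HB.pack f (GRing.isZmodMorphism.Build _ _ f fZ)
  (GRing.isMonoidMorphism.Build _ _ f fM) (GRing.isScalable.Build _ _ _ _ f fS).
by exists F.
Qed.

Section PowerSeriesTheory.
Variables (K : fieldType) (n : nat).
Local Notation S := (pseries K n).
Local Notation m := (aug_ideal (ps_aug K n)).
Implicit Types (f g : S) (u : 'X_{1..n}).

Lemma ps_sumE (J : Type) (r : seq J) (P : pred J) (F : J -> S) u :
  (\sum_(j <- r | P j) F j) u = \sum_(j <- r | P j) F j u.
Proof. exact: (big_morph (fun f : S => f u)). Qed.

Lemma psvar_mulE i f u :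
  (psvar K i * f) u = if u i == 0%N then 0 else f (u - U_(i))%MM.
Proof.
rewrite -[LHS]/(ps_mul _ _ u); case: ifPn => ui.
  rewrite /ps_mul big1 // => k /eqP/(congr1 (fun v : 'X_{1..n} => v i)) uk.
  rewrite /psvar; case: eqP => [kE|]; last by rewrite mul0r.
  by move: uk; rewrite kE mnmDE mnm1E eqxx (eqP ui).
rewrite (@ps_mulE2 _ _ (mdeg u).+1 'X_i) // => [|k _]; last first.
  by rewrite mcoeffX /psvar eq_sym.
have {1}-> : u = ((u - U_(i)) + U_(i))%MM.
  rewrite submK //; apply/mnm_lepP => j; rewrite mnm1E.
  by case: eqP => // <-; rewrite lt0n.
rewrite addmC mulrC mcoeffMX ps_truncE //.
by rewrite ltnS mdegB.
Qed.

(* The part of f divisible by the i-th variable but by no previous one,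
   divided by the i-th variable. *)
Definition ps_quo f (i : 'I_n) : S := fun u =>
  if [forall j : 'I_n, (j < i)%N ==> (u j == 0%N)] then f (u + U_(i))%MM else 0.

Lemma ps_decomp f : f = (ps_const f)%:A + \sum_i psvar K i * ps_quo f i.
Proof.
apply/funext => u; rewrite -[RHS]/(_ + _) ps_sumE.
rewrite -[X in _ = X + _]/(ps_const f * (u == 0%MM)%:R).
under eq_bigr do rewrite psvar_mulE.
have [->|u0] := eqVneq u 0%MM.
  by rewrite mulr1 big1 ?addr0 // => i _; rewrite mnm0E.
rewrite mulr0 add0r.
have [i1 ui1] : exists i, u i != 0%N.
  apply/existsP; apply: contraR u0; rewrite negb_exists => /forallP uz.
  by apply/eqP/mnmP => i; rewrite mnm0E; apply/eqP; rewrite -[_ == _]negbK uz.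
(* The least variable occurring in [u] gives the only summand with a nonzero contribution at [u]. *)
pose i0 := [arg min_(i < i1 | u i != 0%N) (i : nat)].
have [ui0 mini] : u i0 != 0%N /\ forall j, u j != 0%N -> (i0 <= j)%N.
  by rewrite /i0; case: arg_minnP.
have subUK i : u i != 0%N -> (u - U_(i) + U_(i))%MM = u.
  by move=> ui; rewrite submK //; apply/mnm_lepP => j; rewrite mnm1E;
    case: eqP => // <-; rewrite lt0n.
rewrite (bigD1 i0) //= (negPf ui0) /ps_quo subUK // ifT; last first.
  apply/forallP => j; apply/implyP => ji0; rewrite mnmBE.
  have -> : u j = 0%N by apply/eqP/negPn/negP => /mini; rewrite leqNgt ji0.
  by rewrite sub0n.
rewrite big1 ?addr0 // => i ii0; case: ifPn => // ui.
rewrite ifN //; apply/forallPn; exists i0; rewrite negb_imply mnmBE mnm1E.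
rewrite (negPf ii0) subn0 ui0 andbT ltn_neqAle mini // andbT.
by apply: contra ii0 => /eqP /val_inj ->.
Qed.

Lemma ps_trunc_coeff k f u :
  (ps_trunc k f)@_u = if (mdeg u < k)%N then f u else 0.
Proof.
case: ltnP => uk; first exact: ps_truncE.
rewrite /ps_trunc raddf_sum /= big1 // => v _; rewrite mcoeffZ mcoeffX.
case: eqP => [vu|]; last by rewrite mulr0.
by move: (bmdeg v); rewrite vu ltnNge uk.
Qed.

(** The kernel is generated by the finitely many variables, by [ps_decomp], so its powers are the
    filtration by order. Limits can then be taken coefficient by coefficient. *)
Lemma ps_pow_order k f :
  ideal_pow m k f <-> forall u, (mdeg u < k)%N -> f u = 0.
Proof.
split=> [|fk].
  elim: k f => [//|k IH] f [r [a [b [ma mb ->]]]] u uk.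
  rewrite ps_sumE big1 // => i _; rewrite -[LHS]/(ps_mul _ _ u) /ps_mul.
  rewrite big1 // => -[k1 k2] /= /eqP/(congr1 (@mdeg n)); rewrite mdegD => uE.
  have [k10|k10] := eqVneq (bmnm k1) 0%MM.
    by have := ma i; rewrite /aug_ideal /= /ps_const k10 => ->; rewrite mul0r.
  rewrite (IH _ (mb i)) ?mulr0 //.
  apply: leq_trans (_ : mdeg u <= k)%N; last by [].
  rewrite [leqRHS]uE.
  by rewrite -addn1 addnC leq_add2r lt0n mdeg_eq0.
elim: k f fk => [//|k IH] f fk.
rewrite [f]ps_decomp /ps_const fk ?mdeg0 // scale0r add0r.
apply: (@ideal_pow_sum _ _ _ (aug_ideal_ideal _)) => i _.
apply: ideal_pow_mulS; first exact: psvar_const.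
apply: IH => u uk; rewrite /ps_quo; case: ifP => // _; apply: fk.
by rewrite mdegD mdeg1 addn1.
Qed.

Lemma pseries_complete : is_complete m.
Proof.
split=> [f fm|x dx].
  by apply/funext => u; apply: (proj1 (ps_pow_order (mdeg u).+1 f)).
(* The coefficient at [u] no longer changes from the index [(mdeg u).+1] on. *)
exists (fun u => x (mdeg u).+1 u) => k; apply/ps_pow_order => u uk.
rewrite -[LHS]/(_ - _).
have := @ideal_pow_shift _ _ _ (aug_ideal_ideal _) x dx (k - (mdeg u).+1) (mdeg u).+1.
move/ps_pow_order/(_ u (ltnSn _)); rewrite subnK // -[X in X = _]/(_ - _).
by move/eqP; rewrite subr_eq0 => /eqP ->; rewrite subrr.
Qed.

Lemma pseries_formal_base : formal_base (ps_aug K n).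
Proof. exact: complete_formal_base pseries_complete. Qed.

(** * Substitution of elements of the kernel into power series *)

Section Substitution.
Variables (B : comAlgType K) (eps : {lrmorphism B -> K | *%R}).
Hypothesis cB : is_complete (aug_ideal eps).
Variable tau : 'I_n -> B.
Hypothesis tauP : forall i, aug_ideal eps (tau i).

Local Notation mB := (aug_ideal eps).
Let mBI := aug_ideal_ideal eps.
Local Notation ev := (mmap (in_alg B) tau).

Lemma mmap_pow k (p : {mpoly K[n]}) :
  (forall u, (mdeg u < k)%N -> p@_u = 0) -> ideal_pow mB k (ev p).
Proof.
move=> pk; rewrite /mmap; apply: ideal_pow_sum => // u _.
have [uk|uk] := ltnP (mdeg u) k.
  by rewrite pk // rmorph0 mul0r; apply: ideal_pow_0.
apply: ideal_powMl => //; apply: (@ideal_pow_le _ _ _ mBI _ _ _ uk).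
rewrite /mmap1 mdegE.
apply: (big_ind2 (fun d x => ideal_pow mB d x)) => // [d1 x1 d2 x2|i _].
  exact: ideal_powM.
exact: ideal_powX.
Qed.

(** The image of a series is the limit of the values [T k] of its truncations. Limits are unique
    ([FE]), so each law of a morphism only has to hold for truncations up to the [k]-th power, where
    the error consists of monomials of degree at least [k]. *)
Lemma ps_subst_exists :
  exists f : {lrmorphism S -> B}, (forall a, eps (f a) = ps_aug K n a) /\
    forall i, f (psvar K i) = tau i.
Proof.
pose T k f := ev (ps_trunc k f).
have dT f k : ideal_pow mB k (T k.+1 f - T k f).
  rewrite /T -mmapB; apply: mmap_pow => u uk.
  by rewrite mcoeffB !ps_truncE ?subrr // (ltn_trans uk).
have /choice[F FP] f : exists y, forall k, ideal_pow mB k (y - T k f).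
  exact: (proj2 cB _ (dT f)).
have FE f y : (forall k, ideal_pow mB k (y - T k f)) -> F f = y.
  move=> yP; apply: (complete_separated cB) => k.
  have -> : F f - y = (F f - T k f) - (y - T k f) by ring.
  exact: ideal_powB.
have FZ : zmod_morphism F.
  move=> f g; apply: FE => k.
  have -> : T k (f - g) = T k f - T k g.
    rewrite /T -mmapB; congr (ev _); apply/mpolyP => u.
    by rewrite mcoeffB !ps_trunc_coeff; case: ifP; rewrite ?subrr.
  have -> : F f - F g - (T k f - T k g) = (F f - T k f) - (F g - T k g) by ring.
  exact: ideal_powB.
have FM : monoid_morphism F.
  split=> [|f g]; apply: FE => k.
    rewrite -(rmorph1 ev) /T -rmorphB; apply: mmap_pow => u uk.
    by rewrite mcoeffB ps_truncE // mcoeff1 subrr.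
  have -> : F f * F g - T k (f * g) = (F f - T k f) * F g +
     T k f * (F g - T k g) - (T k (f * g) - T k f * T k g) by ring.
  apply: ideal_powB => //.
    by apply: ideal_powD => //; [apply: ideal_powMr | apply: ideal_powMl].
  rewrite /T -rmorphM -rmorphB; apply: mmap_pow => u uk.
  by rewrite mcoeffB ps_truncE // -[_ u]/(ps_mul f g u) (ps_mulE _ _ uk) subrr.
have FS : scalable F.
  move=> c f; apply: FE => k.
  have -> : T k (c *: f) = c *: T k f.
    rewrite /T -[RHS]mulr_algl -[_%:A]/(in_alg B c) -mmapZ; congr (ev _).
    by rewrite /ps_trunc scaler_sumr; apply: eq_bigr => v _; rewrite scalerA.
  by rewrite -scalerBr -mulr_algl; apply: ideal_powMl.
case: (lrmorphism_of FZ FM FS) => h hF; exists h; split=> [a|i].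
  rewrite hF; have := FP a 1%N; rewrite (ideal_pow1 mBI) /aug_ideal rmorphB /=.
  move/eqP; rewrite subr_eq0 => /eqP ->; rewrite /T.
  have -> : ps_trunc 1 a = (ps_const a)%:MP.
    apply/mpolyP => u; rewrite mcoeffC.
    rewrite ps_trunc_coeff ltnS leqn0 mdeg_eq0 eq_sym.
    by case: eqP => [<-|]; rewrite ?mulr1 ?mulr0.
  by rewrite mmapC aug_scale.
rewrite hF; apply: FE => k.
have -> : tau i = ev 'X_i by rewrite mmapX mmap1U.
rewrite -opprB; apply: ideal_powN => //; rewrite /T -mmapB.
by apply: mmap_pow => u uk; rewrite mcoeffB ps_truncE // mcoeffX /psvar eq_sym subrr.
Qed.

(** In [ps_decomp] every quotient is multiplied by a variable, whose image lies in the kernel. So if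
    [f] and [g] agree on all series modulo one power, they agree modulo the next. *)
Lemma ps_morphism_unique (f g : {lrmorphism S -> B}) :
  (forall i, f (psvar K i) = tau i) -> (forall i, g (psvar K i) = tau i) ->
  f =1 g.
Proof.
move=> fv gv s; apply: (complete_separated cB) => k; elim: k s => [//|k IH] s.
have fgE (h : {lrmorphism S -> B}) : h s = (ps_const s)%:A +
    \sum_i h (psvar K i) * h (ps_quo s i).
  rewrite {1}[s]ps_decomp rmorphD /= rmorph_sum /= linearZ /= rmorph1.
  by under eq_bigr do rewrite rmorphM.
rewrite !fgE opprD addrACA subrr add0r -sumrB; apply: ideal_pow_sum => // i _.
by rewrite fv gv -mulrBr; apply: ideal_pow_mulS.
Qed.

End Substitution.
End PowerSeriesTheory.

(** * The base of the deformation of d13(0:0) *)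

Section GeneratedIdeals.
Variable A : comNzRingType.
Implicit Types (s : seq A) (x y z : A).

Lemma ideal_genD s x y : x \in ideal_gen s -> y \in ideal_gen s -> x + y \in ideal_gen s.
Proof.
move=> /asboolP[c ->] /asboolP[e ->]; apply/asboolP; exists (fun i => c i + e i).
by rewrite -big_split; apply: eq_bigr => i _; rewrite mulrDl.
Qed.

Lemma ideal_genM s a x : x \in ideal_gen s -> a * x \in ideal_gen s.
Proof.
move=> /asboolP[c ->]; apply/asboolP; exists (fun i => a * c i).
by rewrite mulr_sumr; apply: eq_bigr => i _; rewrite mulrA.
Qed.

Lemma ideal_gen_mem s x : x \in s -> x \in ideal_gen s.
Proof.
move=> xs; apply/asboolP; have xi : (index x s < size s)%N by rewrite index_mem.
exists (fun i => (i == Ordinal xi)%:R).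
rewrite (bigD1 (Ordinal xi)) //= eqxx mul1r nth_index // big1 ?addr0 // => i.
by move/negPf ->; rewrite mul0r.
Qed.

Lemma ideal_gen2P x y z :
  z \in ideal_gen [:: x; y] <-> exists a b, z = a * x + b * y.
Proof.
split=> [/asboolP[c ->]|[a [b ->]]].
  by exists (c ord0), (c (lift ord0 ord0)); rewrite !big_ord_recl big_ord0 addr0.
by apply: ideal_genD; apply: ideal_genM; apply: ideal_gen_mem; rewrite !inE eqxx ?orbT.
Qed.

Lemma ideal_gen_sub s s' x :
  (forall y, y \in s -> y \in ideal_gen s') -> x \in ideal_gen s -> x \in ideal_gen s'.
Proof.
move=> ss' /asboolP[c ->]; elim/big_ind: _ => [|u v|i _].
- by apply/asboolP; exists (fun=> 0); rewrite big1 // => i; rewrite mul0r.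
- exact: ideal_genD.
by apply: ideal_genM; apply: ss'; rewrite mem_nth.
Qed.

Lemma d13_00_ideal_gens (t1 t2 t3 t4 : A) :
  {subset [:: t1 * t3; t1 * t4; t2 * t3; t2 * t4]
     <= ideal_gen (d13_00_rels t1 t2 t3 t4)}.
Proof.
set I := ideal_gen _.
have mI x : x \in d13_00_rels t1 t2 t3 t4 -> x \in I := @ideal_gen_mem _ x.
have h13 : t1 * t3 \in I by apply: mI; rewrite !inE eqxx ?orbT.
have h14 : t1 * t4 \in I by apply: mI; rewrite !inE eqxx ?orbT.
have h23 : t2 * t3 \in I.
  have -> : t2 * t3 = t1 * t4 + -1 * (t1 * t4 - t2 * t3) by ring.
  by apply: ideal_genD => //; apply/ideal_genM/mI; rewrite inE eqxx.
move=> x; rewrite !inE => /or4P[] /eqP-> //.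
(* The fourth relation reduces to [- t2 * t4] modulo the monomials [t1 * t3] and [t2 * t3]. *)
have -> : t2 * t4 = -1 * ((2 * t1 * t3 - t2) * (t4 - t3 ^+ 2)) +
  (t3 * (t2 * t3) + 2 * (t4 - t3 ^+ 2) * (t1 * t3)) by ring.
apply: ideal_genD; first by apply/ideal_genM/mI; rewrite !inE eqxx ?orbT.
by apply: ideal_genD; apply: ideal_genM.
Qed.

Lemma d13_00_ideal_subl (t1 t2 t3 t4 x : A) :
  x \in ideal_gen (d13_00_rels t1 t2 t3 t4) -> x \in ideal_gen [:: t3; t4].
Proof.
apply: ideal_gen_sub => y; rewrite !inE => yE; apply/ideal_gen2P; move: yE.
case/orP=> [/eqP->|]; first by exists (- t2), t1; ring.
case/orP=> [/eqP->|]; first by exists (2 * t1 * t3), (- t1); ring.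
case/orP=> [/eqP->|]; first by exists t1, 0; ring.
case/orP=> [/eqP->|].
  by exists (- (2 * t1 * t3 - t2) * t3), (2 * t1 * t3 - t2); ring.
case/orP=> [/eqP->|]; first by exists (- t1), t1; ring.
case/orP=> [/eqP->|]; first by exists 0, t1; ring.
case/orP=> [/eqP->|]; first by exists t1, 0; ring.
case/orP=> [/eqP->|/eqP->]; first by exists (t1 * t4), 0; ring.
by exists (t2 - 2 * t1 * t3), t1; ring.
Qed.

Lemma d13_00_ideal_subr (t1 t2 t3 t4 x : A) :
  x \in ideal_gen (d13_00_rels t1 t2 t3 t4) -> x \in ideal_gen [:: t1; t2].
Proof.
apply: ideal_gen_sub => y; rewrite !inE => yE; apply/ideal_gen2P; move: yE.
case/orP=> [/eqP->|]; first by exists t4, (- t3); ring.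
case/orP=> [/eqP->|]; first by exists (2 * t3 ^+ 2 - t4), 0; ring.
case/orP=> [/eqP->|]; first by exists t3, 0; ring.
case/orP=> [/eqP->|].
  by exists (2 * t3 * (t4 - t3 ^+ 2)), (- (t4 - t3 ^+ 2)); ring.
case/orP=> [/eqP->|]; first by exists (t4 - t3), 0; ring.
case/orP=> [/eqP->|]; first by exists t4, 0; ring.
case/orP=> [/eqP->|]; first by exists t3, 0; ring.
case/orP=> [/eqP->|/eqP->]; first by exists (t3 * t4), 0; ring.
by exists (t4 - 2 * t3 ^+ 2), t3; ring.
Qed.

Lemma d13_00_rels_map (B : comNzRingType) (f : {rmorphism A -> B}) t1 t2 t3 t4 :
  map f (d13_00_rels t1 t2 t3 t4) = d13_00_rels (f t1) (f t2) (f t3) (f t4).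
Proof. by rewrite /= !(rmorphD, rmorphN, rmorphM, rmorph1). Qed.

Lemma d13_00_rels_eq0 (t1 t2 t3 t4 : A) :
  t1 * t3 = 0 -> t1 * t4 = 0 -> t2 * t3 = 0 -> t2 * t4 = 0 ->
  forall r, r \in d13_00_rels t1 t2 t3 t4 -> r = 0.
Proof.
move=> h13 h14 h23 h24 r; rewrite !inE.
case/orP=> [/eqP->|]; first by rewrite h14 h23 subrr.
case/orP=> [/eqP->|].
  by transitivity (2 * t3 * (t1 * t3) - t1 * t4); [ring|rewrite h13 h14; ring].
case/orP=> [/eqP->//|].
case/orP=> [/eqP->|].
  transitivity (2 * (t4 - t3 ^+ 2) * (t1 * t3) - t2 * t4 + t3 * (t2 * t3)); first ring.
  by rewrite h13 h23 h24; ring.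
case/orP=> [/eqP->|]; first by rewrite mulrBr h13 h14 subrr.
case/orP=> [/eqP->//|].
case/orP=> [/eqP->//|].
case/orP=> [/eqP->|/eqP->]; first by rewrite h13 mul0r.
transitivity (t1 * t4 + t2 * t3 - 2 * t3 * (t1 * t3)); first ring.
by rewrite h13 h14 h23; ring.
Qed.

End GeneratedIdeals.

(** * The ideal of two coordinate planes and the completeness of its quotient *)

Section TwoPlanes.
Variable K : fieldType.
Local Notation S := (pseries K 4).
Local Notation m := (aug_ideal (ps_aug K 4)).
Local Notation I := (d13_00_ideal K).
Local Notation Q := (d13_00_base K).
Local Notation mQ := (aug_ideal (d13_00_eps K)).
Implicit Types f g : S.

(* The first cofactor collects the monomials involving the i-th variable, the
   second those of the remaining ones that involve the j-th. *)
Lemma psvar_gen2_decomp n (i j : 'I_n) (f : pseries K n) : i != j ->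
  (forall u : 'X_{1..n}, u i = 0%N -> u j = 0%N -> f u = 0) ->
  f = ((fun u => f (u + U_(i))%MM) : pseries K n) * psvar K i +
      ((fun u => if u i == 0%N then f (u + U_(j))%MM else 0) : pseries K n)
        * psvar K j.
Proof.
move=> ij f0.
have UK (k : 'I_n) (u : 'X_{1..n}) : u k != 0%N -> (u - U_(k) + U_(k))%MM = u.
  by move=> uk; rewrite submK //; apply/mnm_lepP => l; rewrite mnm1E;
    case: eqP => // <-; rewrite lt0n.
apply/funext => u; rewrite -[RHS]/((_ * psvar K i) u + (_ * psvar K j) u).
rewrite ![_ * psvar _ _]mulrC !psvar_mulE /= mnmBE mnm1E.
rewrite eq_sym [j == i]eq_sym (negPf ij) subn0.
have [ui|ui] := eqVneq (u i) 0%N; last first.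
  by rewrite UK // if_same addr0.
by rewrite add0r; have [uj|uj] := eqVneq (u j) 0%N; [rewrite f0|rewrite UK].
Qed.

(** This turns membership into the vanishing of individual coefficients, a condition stable under
    limits. *)
Lemma psvar_gen2P n (i j : 'I_n) (f : pseries K n) : i != j ->
  f \in ideal_gen [:: psvar K i; psvar K j] <->
  forall u : 'X_{1..n}, u i = 0%N -> u j = 0%N -> f u = 0.
Proof.
move=> ij; split=> [/ideal_gen2P[a [b ->]] u ui uj|f0].
  by rewrite -[LHS]/((a * psvar K i) u + (b * psvar K j) u) ![_ * psvar _ _]mulrC
    !psvar_mulE ui uj eqxx addr0.
by rewrite (psvar_gen2_decomp ij f0); apply/ideal_gen2P; eexists; eexists.
Qed.

(** For the converse, the cofactors of [f] along the variables 2 and 3 are shifts of [f] that leave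
    the exponents of the variables 0 and 1 unchanged. They therefore inherit the divisibility by the
    latter, and the products that appear are the four monomials. *)
Lemma d13_00_idealP f : f \in I <->
  f \in ideal_gen [:: psvar K 2; psvar K 3] /\
  f \in ideal_gen [:: psvar K 0; psvar K 1].
Proof.
split=> [fI|[]]; first by split;
  [exact: d13_00_ideal_subl fI | exact: d13_00_ideal_subr fI].
move=> /(psvar_gen2P (i := 2) (j := 3) f isT) f23.
move=> /(psvar_gen2P (i := 0) (j := 1) f isT) f0.
rewrite (psvar_gen2_decomp (i := 2) (j := 3) _ f23) //.
have Ig := @d13_00_ideal_gens _ (psvar K 0) (psvar K 1) (psvar K 2) (psvar K 3).
set a := (X in X * _ + _); set b := (X in _ + X * _).
have /ideal_gen2P[a0 [a1 ->]] : a \in ideal_gen [:: psvar K 0; psvar K 1].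
  by apply/psvar_gen2P => // u u0 u1; rewrite /a f0 // mnmDE mnm1E ?u0 ?u1.
have /ideal_gen2P[b0 [b1 ->]] : b \in ideal_gen [:: psvar K 0; psvar K 1].
  by apply/psvar_gen2P => // u u0 u1; rewrite /b f0 ?if_same // mnmDE mnm1E ?u0 ?u1.
rewrite !mulrDl -!mulrA.
by apply: ideal_genD; apply: ideal_genD; apply: ideal_genM; apply: Ig;
  rewrite !inE eqxx ?orbT.
Qed.

(** Closedness of the ideal is what makes the quotient separated. Each coefficient of [f] is that of
    some element of the ideal, and the two conditions of [d13_00_idealP] look at one coefficient at
    a time. *)
Lemma d13_00_ideal_closed_series f :
  (forall k, exists2 g, g \in I & ideal_pow m k (f - g)) -> f \in I.
Proof.
move=> fk; have fg u : exists2 g, g \in I & f u = g u.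
  have [g gI /ps_pow_order/(_ u (ltnSn _))] := fk (mdeg u).+1.
  by rewrite -[LHS]/(_ - _) => /eqP; rewrite subr_eq0 => /eqP; exists g.
apply/d13_00_idealP; split; apply/psvar_gen2P => // u u1 u2;
  have [g /d13_00_idealP[g1 g2] ->] := fg u.
  exact: (proj1 (psvar_gen2P (i := 2) (j := 3) g isT) g1).
exact: (proj1 (psvar_gen2P (i := 0) (j := 1) g isT) g2).
Qed.

(** The projection gets its own name so that it can carry the [K]-linear structure and be composed
    with algebra morphisms. *)
Definition d13_00_pi f : Q := \pi_{ideal_quot I}%qT f.
Local Notation pi := d13_00_pi.

Fact d13_00_pi_zmod : zmod_morphism pi.
Proof. by move=> f g; rewrite /pi rmorphB. Qed.
HB.instance Definition _ := GRing.isZmodMorphism.Build S Q pi d13_00_pi_zmod.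
Fact d13_00_pi_monoid : monoid_morphism pi.
Proof. by split=> [|f g]; rewrite /pi ?rmorph1 ?rmorphM. Qed.
HB.instance Definition _ := GRing.isMonoidMorphism.Build S Q pi d13_00_pi_monoid.
Fact d13_00_pi_scalable : scalable pi.
Proof. by move=> c f; rewrite -[RHS]/(iq_scale _ _) pi_iq_scale. Qed.
HB.instance Definition _ := GRing.isScalable.Build K S Q *:%R pi d13_00_pi_scalable.

Lemma d13_00_pi_eq f g : pi f = pi g <-> f - g \in I.
Proof. by rewrite Quotient.idealrBE; split=> [/eqP|/eqP]. Qed.

Lemma d13_00_pi_surj (x : Q) : pi (repr x) = x.
Proof. exact: reprK. Qed.

Lemma d13_00_pi_lift k x : ideal_pow mQ k x -> exists2 f, ideal_pow m k f & pi f = x.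
Proof.
elim: k x => [|k IH] x /=; first by move=> _; exists (repr x); rewrite ?d13_00_pi_surj.
move=> [r [a [b [ma mb ->]]]].
have /choice[F FP] i : exists f, ideal_pow m k f /\ pi f = b i.
  by have [f] := IH _ (mb i); exists f.
exists (\sum_(i < r) repr (a i) * F i).
  by exists r, (repr \o a), F; split=> // i; case: (FP i).
rewrite rmorph_sum; apply: eq_bigr => i _.
by rewrite rmorphM /= d13_00_pi_surj; case: (FP i) => _ ->.
Qed.

Lemma d13_00_pi_pow k f : ideal_pow m k f -> ideal_pow mQ k (pi f).
Proof.
elim: k f => [//|k IH] f [r [a [b [ma mb ->]]]].
rewrite rmorph_sum; apply: ideal_pow_sum; first exact: aug_ideal_ideal.
move=> i _; rewrite rmorphM; apply: ideal_pow_mulS; last exact: IH (mb i).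
by rewrite /aug_ideal [LHS]d13_00_augE; apply: ma.
Qed.

Lemma d13_00_complete : is_complete mQ.
Proof.
split=> [x xk|x dx].
  rewrite -(d13_00_pi_surj x) -(rmorph0 pi); apply/d13_00_pi_eq; rewrite subr0.
  apply: d13_00_ideal_closed_series => k.
  have [f fk fx] := d13_00_pi_lift (xk k).
  exists (repr x - f); last by rewrite opprB addrC subrK.
  by apply/d13_00_pi_eq; rewrite d13_00_pi_surj.
(* The increments are lifted, not the terms: the partial sums of the lifts then form a Cauchy
   sequence upstairs. *)
have /choice[z zP] k : exists f, ideal_pow m k f /\ pi f = x k.+1 - x k.
  by have [f] := d13_00_pi_lift (dx k); exists f.
pose y k := repr (x 0%N) + \sum_(j < k) z j.
have yE k : pi (y k) = x k.
  rewrite /y rmorphD rmorph_sum /= d13_00_pi_surj; elim: k => [|k IH].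
    by rewrite big_ord0 addr0.
  by rewrite big_ord_recr /= addrA IH; case: (zP k) => _ ->; rewrite addrC subrK.
have dy k : ideal_pow m k (y k.+1 - y k).
  rewrite /y big_ord_recr /= [in X in X - _]addrA [_ + z k]addrC addrK.
  by case: (zP k).
have [l lP] := proj2 (pseries_complete K 4) y dy.
exists (pi l) => k; rewrite -yE -rmorphB; exact: d13_00_pi_pow.
Qed.

Section Universal.
Variables (B : comAlgType K) (eps : {lrmorphism B -> K | *%R}).
Hypothesis cB : is_complete (aug_ideal eps).

Lemma d13_00_morphism_exists (tau : 'I_4 -> B) :
  (forall i, aug_ideal eps (tau i)) ->
  tau 0 * tau 2 = 0 -> tau 0 * tau 3 = 0 -> tau 1 * tau 2 = 0 -> tau 1 * tau 3 = 0 ->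
  exists f : {lrmorphism Q -> B}, (forall x, eps (f x) = d13_00_eps K x) /\
    forall i, f (d13_00_var K i) = tau i.
Proof.
move=> mtau h13 h14 h23 h24; have [h [he hv]] := ps_subst_exists cB mtau.
have hI f : f \in I -> h f = 0.
  move=> /asboolP[c ->]; rewrite rmorph_sum big1 //= => i _.
  rewrite rmorphM /=; set s := d13_00_rels _ _ _ _.
  have : h s`_i \in d13_00_rels (tau 0) (tau 1) (tau 2) (tau 3).
    rewrite -!hv -(d13_00_rels_map h).
    by apply: map_f; rewrite mem_nth // [size s](_ : _ = 9%N).
  by move/(d13_00_rels_eq0 h13 h14 h23 h24) ->; rewrite mulr0.
(* The choice of representative does not matter, as [h] vanishes on the ideal. *)
have hpi f : h (repr (pi f)) = h f.
  apply/eqP; rewrite -subr_eq0 -rmorphB /=; apply/eqP/hI/d13_00_pi_eq.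
  exact: d13_00_pi_surj.
pose F (x : Q) := h (repr x).
have FZ : zmod_morphism F.
  move=> x y; rewrite -(d13_00_pi_surj x) -(d13_00_pi_surj y) -rmorphB.
  by rewrite /F !hpi rmorphB.
have FM : monoid_morphism F.
  split=> [|x y]; first by rewrite -(rmorph1 pi) /F hpi rmorph1.
  rewrite -(d13_00_pi_surj x) -(d13_00_pi_surj y) -rmorphM.
  by rewrite /F !hpi rmorphM.
have FS : scalable F.
  by move=> c x; rewrite -(d13_00_pi_surj x) -linearZ /F !hpi linearZ.
have [f fF] := lrmorphism_of FZ FM FS; exists f; split=> [x|i]; rewrite fF.
  by rewrite /F he.
by rewrite /F [d13_00_var K i]/(pi _) hpi.
Qed.

Lemma d13_00_morphism_unique (tau : 'I_4 -> B) (f g : {lrmorphism Q -> B}) :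
  (forall i, aug_ideal eps (tau i)) ->
  (forall i, f (d13_00_var K i) = tau i) -> (forall i, g (d13_00_var K i) = tau i) ->
  f =1 g.
Proof.
move=> mtau fv gv x; rewrite -(d13_00_pi_surj x).
pose f' : {lrmorphism S -> B} := f \o pi.
pose g' : {lrmorphism S -> B} := g \o pi.
apply: (ps_morphism_unique cB mtau (f := f') (g := g')) => i.
  exact: fv.
exact: gv.
Qed.

End Universal.
End TwoPlanes.

(** * Cochains and their conjugates *)

(** The three cases are the numerals of the ring ['I_3], so that goals match hypotheses written with
    [0], [1], [2]; here [2] stands for the odd vector v_3. *)
Lemma forall_ord3 (P : 'I_3 -> Prop) : P 0 -> P 1 -> P 2 -> forall i, P i.
Proof.
by move=> P0 P1 P2 [[|[|[|//]]] i3]; [move: P0|move: P1|move: P2];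
  congr P; apply: val_inj.
Qed.

Lemma forall_ord4 (P : 'I_4 -> Prop) : P 0 -> P 1 -> P 2 -> P 3 -> forall i, P i.
Proof.
by move=> P0 P1 P2 P3 [[|[|[|[|//]]]] i4];
  [move: P0|move: P1|move: P2|move: P3]; congr P; apply: val_inj.
Qed.

Lemma sum_ord3 (V : nmodType) (F : 'I_3 -> V) : \sum_i F i = F 0 + F 1 + F 2.
Proof.
rewrite !big_ord_recl big_ord0 addr0 addrA.
by congr (_ + F _ + F _); apply: val_inj.
Qed.

Ltac cochain_eq :=
  let i := fresh in let j := fresh in let l := fresh in
  apply/ffunP => -[i j]; apply/rowP => l; rewrite !(ffunE, mxE);
  move: i j l; apply: forall_ord3; apply: forall_ord3; apply: forall_ord3; rewrite /=.


Section Cochains.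
Variable A : comNzRingType.
Implicit Types (d : cochain A) (x y : 'rV[A]_3) (g h : 'M[A]_3).
Local Notation e_ i := (delta_mx 0 i : 'rV[A]_3).

Lemma ext_is_linear_l d y : linear (ext d ^~ y).
Proof.
move=> a x x'; rewrite /ext scaler_sumr -big_split; apply: eq_bigr => i _ /=.
rewrite scaler_sumr -big_split; apply: eq_bigr => j _ /=.
by rewrite !mxE mulrDl scalerDl scalerA mulrA.
Qed.
Lemma ext_is_linear_r d x : linear (ext d x).
Proof.
move=> a y y'; rewrite /ext scaler_sumr -big_split; apply: eq_bigr => i _ /=.
rewrite scaler_sumr -big_split; apply: eq_bigr => j _ /=.
by rewrite !mxE mulrDr scalerDl scalerA mulrCA.
Qed.
HB.instance Definition _ d x :=
  GRing.isLinear.Build A 'rV[A]_3 'rV[A]_3 _ (ext d x) (ext_is_linear_r d x).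

Lemma ext_suml d y (I : finType) (a : I -> A) (u : I -> 'rV[A]_3) :
  ext d (\sum_i a i *: u i) y = \sum_i a i *: ext d (u i) y.
Proof.
pose F : {linear 'rV[A]_3 -> 'rV[A]_3} := HB.pack (ext d ^~ y)
  (GRing.isLinear.Build A _ _ _ (ext d ^~ y) (ext_is_linear_l d y)).
by rewrite -[LHS]/(F _) linear_sum; apply: eq_bigr => i _; rewrite linearZ.
Qed.

Lemma ext_sumr d x (I : finType) (a : I -> A) (u : I -> 'rV[A]_3) :
  ext d x (\sum_i a i *: u i) = \sum_i a i *: ext d x (u i).
Proof. by rewrite linear_sum; apply: eq_bigr => i _; rewrite linearZ. Qed.

Lemma ext_basis d i j : ext d (e_ i) (e_ j) = d (i, j).
Proof.
rewrite /ext (bigD1 i) //= (bigD1 j) //= !mxE !eqxx mul1r scale1r.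
rewrite !big1 ?addr0 // => [k ki|k kj]; last by rewrite !mxE (negPf kj) mulr0 scale0r.
by rewrite big1 // => l _; rewrite !mxE (negPf ki) mul0r scale0r.
Qed.

Lemma ext_basisr d x k : ext d x (e_ k) = \sum_i x 0 i *: d (i, k).
Proof.
by rewrite {1}[x]row_sum_delta ext_suml; apply: eq_bigr => i _; rewrite ext_basis.
Qed.

Lemma ext_basisl d y k : ext d (e_ k) y = \sum_i y 0 i *: d (k, i).
Proof.
by rewrite {1}[y]row_sum_delta ext_sumr; apply: eq_bigr => i _; rewrite ext_basis.
Qed.

Lemma codifferentialP d : codifferential d <-> odd_cochain d /\
  forall i j k l, \sum_s d (i, j) 0 s * d (s, k) 0 l +
    (-1) ^+ par i * \sum_s d (j, k) 0 s * d (i, s) 0 l = 0.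
Proof.
split=> -[dodd dd]; split=> //.
  move=> i j k l.
  have hom s : homogeneous (par s) (e_ s).
    by move=> r; rewrite mxE /=; have [->|//] := eqVneq r s; rewrite eqxx.
  have := dd _ _ _ _ _ _ (hom i) (hom j) (hom k).
  rewrite !ext_basis ext_basisr ext_basisl => /(congr1 (fun x : 'rV_3 => x 0 l)).
  rewrite !mxE !summxE => e; rewrite -[RHS]e; congr (_ + _ * _);
  by apply: eq_bigr => s _; rewrite mxE.
move=> a b c x y z xa yb zc.
have dd' i j k : ext d (d (i, j)) (e_ k) + (-1) ^+ par i *: ext d (e_ i) (d (j, k)) = 0.
  apply/rowP => l; rewrite ext_basisr ext_basisl !mxE !summxE -[RHS](dd i j k l).
  by congr (_ + _ * _); apply: eq_bigr => s _; rewrite mxE.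
have -> : ext d (ext d x y) z =
  \sum_i \sum_j \sum_k (x 0 i * y 0 j * z 0 k) *: ext d (d (i, j)) (e_ k).
  rewrite {1}[x]row_sum_delta !ext_suml; apply: eq_bigr => i _.
  rewrite ext_basisl ext_suml !scaler_sumr; apply: eq_bigr => j _.
  rewrite {1}[z]row_sum_delta ext_sumr !scaler_sumr; apply: eq_bigr => k _.
  by rewrite !scalerA.
have -> : (-1) ^+ a *: ext d x (ext d y z) =
  \sum_i \sum_j \sum_k (x 0 i * y 0 j * z 0 k) *:
     ((-1) ^+ par i *: ext d (e_ i) (d (j, k))).
  rewrite {1}[x]row_sum_delta ext_suml scaler_sumr; apply: eq_bigr => i _.
  rewrite {1}[y]row_sum_delta ext_suml ext_sumr !scaler_sumr; apply: eq_bigr => j _.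
  rewrite (ext_basisl _ z) ext_sumr !scaler_sumr; apply: eq_bigr => k _.
  rewrite !scalerA; congr (_ *: _).
  (* Only basis vectors of parity [a] occur in [x], so the sign may be taken from [i]. *)
  have [<-|ia] := eqVneq (par i) a; first by ring.
  by rewrite xa //; ring.
rewrite -big_split big1 //= => i _; rewrite -big_split big1 //= => j _.
by rewrite -big_split big1 //= => k _; rewrite -scalerDr dd' scaler0.
Qed.

Lemma codifferential_odd d i j l :
  codifferential d -> par l == (par i (+) par j) -> d (i, j) 0 l = 0.
Proof. by case=> dodd _ /eqP lij; apply: dodd; rewrite lij; case: (_ (+) _). Qed.

(** Multiplying by [g] removes the inverse and leaves equations on basis vectors that are polynomial
    in the entries of [g]. *)
Lemma conjugate_byP d d' g h : g *m h = 1%:M -> h *m g = 1%:M ->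
  (forall x y, ext d' x y = ext d (x *m g) (y *m g) *m h) <->
  (forall i j, d' (i, j) *m g = ext d (row i g) (row j g)).
Proof.
move=> gh hg; split=> [dd' i j|dd' x y].
  by rewrite -ext_basis dd' -!rowE -mulmxA hg mulmx1.
rewrite (mulmx_sum_row x) (mulmx_sum_row y) ext_suml mulmx_suml.
rewrite {1}[x]row_sum_delta ext_suml.
apply: eq_bigr => i _; rewrite -scalemxAl; congr (_ *: _).
rewrite ext_sumr mulmx_suml {1}[y]row_sum_delta ext_sumr.
apply: eq_bigr => j _; rewrite -scalemxAl; congr (_ *: _).
by rewrite ext_basis -dd' -mulmxA gh mulmx1.
Qed.

End Cochains.

(** * Even matrices and conjugation *)

Section EvenMatrices.
Variable A : comNzRingType.
Implicit Types (d : cochain A) (x y : 'rV[A]_3) (g h : 'M[A]_3).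

Lemma even_mxM g h : even_mx g -> even_mx h -> even_mx (g *m h).
Proof.
move=> ge he i j ij; rewrite mxE big1 // => k _.
have [ik|ik] := eqVneq (par i) (par k); last by rewrite ge ?mul0r.
by rewrite he ?mulr0 // -ik.
Qed.

Lemma even_mxD g h : even_mx g -> even_mx h -> even_mx (g + h).
Proof. by move=> ge he i j ij; rewrite mxE ge ?he ?addr0. Qed.

Lemma even_mxN g : even_mx g -> even_mx (- g).
Proof. by move=> ge i j ij; rewrite mxE ge ?oppr0. Qed.

Lemma even_mx1 : even_mx (1%:M : 'M[A]_3).
Proof. by move=> i j; rewrite mxE; have [->|//] := eqVneq i j; rewrite eqxx. Qed.

(* The even part of an inverse of an even matrix is an inverse too. *)
Lemma even_mx_inv g h : even_mx g -> g *m h = 1%:M -> h *m g = 1%:M -> even_mx h.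
Proof.
move=> ge gh hg.
pose he : 'M[A]_3 := \matrix_(i, j) (if par i == par j then h i j else 0).
have ghe : g *m he = 1%:M.
  apply/matrixP => i j; rewrite -gh !mxE.
  have [ij|ij] := eqVneq (par i) (par j); last first.
    transitivity ((1%:M : 'M[A]_3) i j); last by rewrite -gh mxE.
    rewrite even_mx1 // big1 // => k _; rewrite mxE.
    have [ik|ik] := eqVneq (par i) (par k); last by rewrite ge ?mul0r.
    by rewrite -ik (negPf ij) mulr0.
  apply: eq_bigr => k _; rewrite mxE -ij.
  by have [//|ki] := eqVneq (par k) (par i); rewrite ge ?mul0r // eq_sym.
have -> : h = he by rewrite -[he]mul1mx -hg -mulmxA ghe mulmx1.
by move=> i j ij; rewrite mxE (negPf ij).
Qed.

Lemma homogeneous_mul a x g : even_mx g -> homogeneous a x -> homogeneous a (x *m g).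
Proof.
move=> ge xa i ia; rewrite mxE big1 // => k _.
have [ka|ka] := eqVneq (par k) a; last by rewrite xa ?mul0r.
by rewrite ge ?mulr0 // ka eq_sym.
Qed.

Lemma homogeneous_ext d a b x y : odd_cochain d -> homogeneous a x ->
  homogeneous b y -> homogeneous (~~ (a (+) b)) (ext d x y).
Proof.
move=> dodd xa yb l la; rewrite summxE big1 // => i _; rewrite summxE big1 // => j _.
rewrite mxE; have [ia|ia] := eqVneq (par i) a; last by rewrite xa ?mul0r ?mul0r.
have [jb|jb] := eqVneq (par j) b; last by rewrite yb ?mulr0 ?mul0r.
by rewrite dodd ?mulr0 // ia jb.
Qed.

Lemma homogeneous_basis i : homogeneous (par i) (delta_mx 0 i : 'rV[A]_3).
Proof. by move=> r; rewrite mxE /=; have [->|//] := eqVneq r i; rewrite eqxx. Qed.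

Lemma codifferential_conj d d' g :
  even_mx g -> conjugate_by g d d' -> codifferential d -> codifferential d'.
Proof.
move=> ge [h [gh hg dd']] [dodd dd]; have he := even_mx_inv ge gh hg.
split=> [i j|a b c x y z xa yb zc].
  rewrite -ext_basis dd'; apply: homogeneous_mul => //.
  by apply: homogeneous_ext => //; apply: homogeneous_mul => //; apply: homogeneous_basis.
rewrite !dd' -!mulmxA hg !mulmx1 scalemxAl -mulmxDl.
rewrite (dd a b c) ?mul0mx //; exact: homogeneous_mul.
Qed.

Lemma conjugate_by_sym d d' g h : g *m h = 1%:M -> h *m g = 1%:M ->
  conjugate_by g d d' -> conjugate_by h d' d.
Proof.
move=> gh hg [h' [gh' hg' dd']].
have hh' : h = h' by rewrite -[h]mulmx1 -gh' mulmxA hg mul1mx.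
subst h'; exists g; split=> // x y.
by rewrite dd' -!mulmxA hg !mulmx1.
Qed.

(** The factors appear in the order [g' *m g] because matrices act on rows from the right. *)
Lemma conjugate_by_trans d d' d'' g g' :
  conjugate_by g d d' -> conjugate_by g' d' d'' -> conjugate_by (g' *m g) d d''.
Proof.
move=> [h [gh hg dd]] [h' [gh' hg' dd']]; exists (h *m h'); split=> [||x y].
- by rewrite mulmxA -(mulmxA g') gh mulmx1.
- by rewrite mulmxA -(mulmxA h) hg' mulmx1.
by rewrite dd' dd !mulmxA.
Qed.

Definition conj_cochain g h d : cochain A :=
  [ffun ij => ext d (row ij.1 g) (row ij.2 g) *m h].

Lemma conj_cochainP g h d : g *m h = 1%:M -> h *m g = 1%:M ->
  conjugate_by g d (conj_cochain g h d).
Proof.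
move=> gh hg; exists h; split=> //.
by apply/conjugate_byP => // i j; rewrite ffunE -mulmxA hg mulmx1.
Qed.

Lemma conjugate_by_coef d d' g i j l : conjugate_by g d d' ->
  \sum_k d' (i, j) 0 k * g k l = \sum_k \sum_r g i k * g j r * d (k, r) 0 l.
Proof.
case=> h [gh hg /(conjugate_byP _ _ gh hg) /(_ i j)].
move=> /(congr1 (fun x : 'rV_3 => x 0 l)); rewrite mxE => ->.
rewrite summxE; apply: eq_bigr => k _; rewrite summxE; apply: eq_bigr => r _.
by rewrite !mxE.
Qed.

End EvenMatrices.

Section CochainMap.
Variables (A B : comNzRingType) (f : {rmorphism A -> B}).
Implicit Types d : cochain A.

Lemma cochain_mapD d d' : cochain_map f (d + d') = cochain_map f d + cochain_map f d'.
Proof. by apply/ffunP => ij; rewrite !ffunE map_mxD. Qed.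
Lemma cochain_mapN d : cochain_map f (- d) = - cochain_map f d.
Proof. by apply/ffunP => ij; rewrite !ffunE map_mxN. Qed.
Lemma cochain_mapZ a d : cochain_map f (a *: d) = f a *: cochain_map f d.
Proof. by apply/ffunP => ij; rewrite !ffunE map_mxZ. Qed.
Lemma cochain_map_psi i j k : cochain_map f (psi i j k) = psi i j k.
Proof. by apply/ffunP => ij; rewrite !ffunE; apply/rowP => l; rewrite !mxE rmorph_nat. Qed.
Definition cochain_mapE := (cochain_mapD, cochain_mapN, cochain_mapZ, cochain_map_psi).

Lemma map_ext d x y :
  map_mx f (ext d x y) = ext (cochain_map f d) (map_mx f x) (map_mx f y).
Proof.
rewrite /ext (map_mx_sum f); apply: eq_bigr => i _; rewrite (map_mx_sum f).
by apply: eq_bigr => j _; rewrite map_mxZ rmorphM ffunE !mxE.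
Qed.

Lemma cochain_map_conj d d' g :
  conjugate_by g d d' -> conjugate_by (map_mx f g) (cochain_map f d) (cochain_map f d').
Proof.
move=> [h [gh hg dd']]; exists (map_mx f h).
have gh' : map_mx f g *m map_mx f h = 1%:M by rewrite -map_mxM gh map_mx1.
have hg' : map_mx f h *m map_mx f g = 1%:M by rewrite -map_mxM hg map_mx1.
split=> //; apply/conjugate_byP => // i j.
have /(_ i j) e := proj1 (conjugate_byP _ _ gh hg) dd'.
by rewrite ffunE -map_mxM e map_ext !map_row.
Qed.

End CochainMap.

(** * Deformations as lifts along the augmentation *)

Section Deformations.
Variables (K : fieldType) (d : cochain K).
Variables (B : comAlgType K) (eps : {lrmorphism B -> K | *%R}).
Local Notation m := (aug_ideal eps).
Implicit Types dB : cochain B.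

(** The summand [phi] is determined as a difference, so a deformation is a codifferential reducing
    to [d], a condition easily followed through conjugation. *)
Lemma deformationP dB : odd_cochain d ->
  deformation d eps dB <-> codifferential dB /\ cochain_map eps dB = d.
Proof.
move=> dodd; split=> [[dd [phi [podd pm dE]]]|[dd de]].
  split=> //; rewrite dE; apply/ffunP => ij; apply/rowP => k; rewrite !ffunE !mxE rmorphD.
  by rewrite /= (pm ij k) addr0 linearZ /= rmorph1 mulr1.
split=> //; exists (dB - cochain_map (in_alg B) d); split.
- move=> i j l lij; rewrite !ffunE !mxE (proj1 dd) // dodd //.
  by rewrite rmorph0 subrr.
- move=> ij k; rewrite /aug_ideal !ffunE !mxE rmorphB /= linearZ /= rmorph1 mulr1.
  by rewrite -de ffunE mxE subrr.
by rewrite addrC subrK.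
Qed.

Lemma map_aug_1D (lam : 'M[B]_3) : (forall i j, m (lam i j)) ->
  map_mx eps (1%:M + lam) = 1%:M.
Proof.
move=> ml; apply/matrixP => i j; rewrite !mxE rmorphD /= ml addr0.
by rewrite rmorph_nat.
Qed.

Lemma aug_inverse (g h : 'M[B]_3) : map_mx eps g = 1%:M -> g *m h = 1%:M ->
  map_mx eps h = 1%:M.
Proof. by move=> g1 /(congr1 (map_mx eps)); rewrite map_mxM g1 mul1mx map_mx1. Qed.

Lemma equivalent_deformationsP dB dB' :
  equivalent_deformations eps dB dB' <->
  exists g, [/\ even_mx g, map_mx eps g = 1%:M & conjugate_by g dB dB'].
Proof.
split=> [[lam [le lm c]]|[g [ge gm c]]].
  exists (1%:M + lam); split=> //; last exact: map_aug_1D.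
  by apply: even_mxD => //; apply: even_mx1.
exists (g - 1%:M); split.
- by apply: even_mxD => //; apply/even_mxN/even_mx1.
- move=> i j; rewrite /aug_ideal; have /matrixP/(_ i j) := gm.
  by rewrite !mxE rmorphB /= => ->; rewrite rmorph_nat subrr.
by rewrite addrC subrK.
Qed.

Lemma equivalent_deformations_sym dB dB' :
  equivalent_deformations eps dB dB' -> equivalent_deformations eps dB' dB.
Proof.
move=> /equivalent_deformationsP[g [ge gm c]]; have [h [gh hg _]] := c.
apply/equivalent_deformationsP; exists h; split.
- exact: even_mx_inv gh hg.
- exact: aug_inverse gh.
exact: conjugate_by_sym c.
Qed.

Lemma equivalent_deformations_trans dB dB' dB'' :
  equivalent_deformations eps dB dB' -> equivalent_deformations eps dB' dB'' ->
  equivalent_deformations eps dB dB''.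
Proof.
move=> /equivalent_deformationsP[g [ge gm c]] /equivalent_deformationsP[g' [ge' gm' c']].
apply/equivalent_deformationsP; exists (g' *m g); split.
- exact: even_mxM.
- by rewrite map_mxM gm gm' mulmx1.
exact: conjugate_by_trans c'.
Qed.

Lemma deformation_conj dB g h : odd_cochain d -> deformation d eps dB ->
  even_mx g -> map_mx eps g = 1%:M -> g *m h = 1%:M -> h *m g = 1%:M ->
  deformation d eps (conj_cochain g h dB) /\
  equivalent_deformations eps (conj_cochain g h dB) dB.
Proof.
move=> dodd /(deformationP _ dodd)[dd de] ge gm gh hg.
have c := conj_cochainP dB gh hg; split.
  apply/(deformationP _ dodd); split; first exact: codifferential_conj c dd.
  have [h' [_ e1 e2]] := cochain_map_conj eps c; rewrite gm !mulmx1 in e1 e2.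
  apply/ffunP => -[i j]; rewrite -ext_basis e2 e1 !mulmx1 ext_basis.
  by rewrite -de.
apply: equivalent_deformations_sym; apply/equivalent_deformationsP.
by exists g.
Qed.

End Deformations.

(** * Normal forms *)

Section NormalForms.
Variable A : comNzRingType.
Implicit Types (d : cochain A) (g h : 'M[A]_3).

Definition form_cochain (a11 a12 a21 a22 : A) : cochain A :=
  a11 *: psi 1 1 3 + a12 *: psi 1 2 3 + a21 *: psi 2 1 3 + a22 *: psi 2 2 3.

(** What is left of [d13_00_inf] when [t1 * t3], [t1 * t4] and [t2 * t3] vanish; it is also the
    normal form of a codifferential with a12 = 0 and a22 = 1. *)
Definition plane_cochain (t1 t2 t3 t4 : A) : cochain A :=
  form_cochain t4 0 t3 1 + t1 *: (psi 3 2 1 - psi 2 3 1)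
    + t2 *: (psi 3 2 2 - psi 2 3 2 + psi 3 3 3).

Lemma plane_cochain_form t3 t4 : plane_cochain 0 0 t3 t4 = form_cochain t4 0 t3 1.
Proof. by rewrite /plane_cochain !scale0r !addr0. Qed.

Lemma d13E p q : d13 p q = form_cochain 0 q p 1.
Proof. by cochain_eq; ring. Qed.

Lemma d13_00_infE t1 t2 t3 t4 :
  t1 * t3 = 0 -> t1 * t4 = 0 -> t2 * t3 = 0 ->
  d13_00_inf t1 t2 t3 t4 = plane_cochain t1 t2 t3 t4.
Proof.
move=> h13 h14 h23.
have h133 : 2 * t3 ^+ 2 * t1 = 0 by rewrite -(mulr0 (2 * t3)) -h13; ring.
rewrite /d13_00_inf -[2 * t1 * t3]mulrA h13 h14 h23 h133 !(mulr0, subr0, addr0).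
by cochain_eq; ring.
Qed.

Lemma d13_00_inf_plane1 (t1 t2 : A) : d13_00_inf t1 t2 0 0 =
  psi 2 2 3 + t1 *: (psi 3 2 1 - psi 2 3 1) + t2 *: (psi 3 2 2 - psi 2 3 2 + psi 3 3 3).
Proof. by rewrite d13_00_infE ?mulr0 //; cochain_eq; ring. Qed.

Lemma d13_00_inf_plane2 (t3 t4 : A) :
  d13_00_inf 0 0 t3 t4 = psi 2 2 3 + t3 *: psi 2 1 3 + t4 *: psi 1 1 3.
Proof. by rewrite d13_00_infE ?mul0r //; cochain_eq; ring. Qed.

(** A table that computes, with indices counted from 0 whereas [psi] counts from 1; it reduces the
    codifferential identity to ring identities. *)
Definition plane_coef (t1 t2 t3 t4 : A) (i j l : nat) : A :=
  match i, j, l with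
  | 0%N, 0%N, 2%N => t4 | 1%N, 0%N, 2%N => t3 | 1%N, 1%N, 2%N => 1 | 2%N, 2%N, 2%N => t2
  | 2%N, 1%N, 0%N => t1 | 1%N, 2%N, 0%N => - t1
  | 2%N, 1%N, 1%N => t2 | 1%N, 2%N, 1%N => - t2
  | _, _, _ => 0
  end.

Lemma plane_cochainE t1 t2 t3 t4 (i j l : 'I_3) :
  plane_cochain t1 t2 t3 t4 (i, j) 0 l = plane_coef t1 t2 t3 t4 i j l.
Proof.
rewrite !(ffunE, mxE); move: i j l.
by apply: forall_ord3; apply: forall_ord3; apply: forall_ord3; rewrite /=; ring.
Qed.

Lemma codifferential_plane t1 t2 t3 t4 :
  t1 * t3 = 0 -> t1 * t4 = 0 -> t2 * t3 = 0 -> t2 * t4 = 0 ->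
  codifferential (plane_cochain t1 t2 t3 t4).
Proof.
move=> h13 h14 h23 h24; apply/codifferentialP; split.
  move=> i j l; rewrite plane_cochainE.
  by move: i j l; do 3!apply: forall_ord3.
move=> i j k l; rewrite !sum_ord3 !plane_cochainE; move: i j k l.
do 4!apply: forall_ord3; rewrite /= ?expr0 ?expr1.
all: first [ring
  | transitivity (t1 * t3); [ring|done] | transitivity (t1 * t4); [ring|done]
  | transitivity (t2 * t3); [ring|done] | transitivity (t2 * t4); [ring|done]
  | transitivity (- (t1 * t3)); [ring|by rewrite h13 oppr0]
  | transitivity (- (t1 * t4)); [ring|by rewrite h14 oppr0]
  | transitivity (- (t2 * t3)); [ring|by rewrite h23 oppr0]
  | transitivity (- (t2 * t4)); [ring|by rewrite h24 oppr0]
  | transitivity (- (t1 * t4) - t2 * t3); [ring|by rewrite h14 h23 subr0 oppr0]].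
Qed.

Definition form_coef (a11 a12 a21 a22 : A) (i j l : nat) : A :=
  match i, j, l with
  | 0%N, 0%N, 2%N => a11 | 0%N, 1%N, 2%N => a12
  | 1%N, 0%N, 2%N => a21 | 1%N, 1%N, 2%N => a22 | _, _, _ => 0
  end.

Lemma form_cochainE a11 a12 a21 a22 (i j l : 'I_3) :
  form_cochain a11 a12 a21 a22 (i, j) 0 l = form_coef a11 a12 a21 a22 i j l.
Proof.
rewrite !(ffunE, mxE); move: i j l.
by do 3!apply: forall_ord3; rewrite /=; ring.
Qed.

Lemma codifferential_form a11 a12 a21 a22 :
  codifferential (form_cochain a11 a12 a21 a22).
Proof.
apply/codifferentialP; split.
  move=> i j l; rewrite form_cochainE.
  by move: i j l; do 3!apply: forall_ord3.
move=> i j k l; rewrite !sum_ord3 !form_cochainE; move: i j k l.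
by do 4!apply: forall_ord3; rewrite /=; ring.
Qed.

(** The first equation comes from triples of even vectors, the second from the v_3 component on
    triples (v_i, v_j, v_3). They determine the products with v_3 once a22 is invertible. *)
Lemma codifferential_equations d : codifferential d ->
  (forall i j k l, par i = false -> par j = false -> par k = false -> par l = false ->
     d (i, j) 0 2 * d (2, k) 0 l + d (j, k) 0 2 * d (i, 2) 0 l = 0) /\
  (forall i j, par i = false -> par j = false ->
     d (i, j) 0 2 * d (2, 2) 0 2 +
       (d (j, 2) 0 0 * d (i, 0) 0 2 + d (j, 2) 0 1 * d (i, 1) 0 2) = 0).
Proof.
move=> dd; have [_ E] := proj1 (codifferentialP d) dd; split.
  move=> i j k l pi pj pk pl; have := E i j k l; rewrite !sum_ord3 pi expr0 mul1r.
  have Z r s t : par r = false -> par s = false -> par t = false -> d (r, s) 0 t = 0.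
    by move=> pr ps pt; rewrite (codifferential_odd dd) // pr ps pt.
  by rewrite (Z i j 0) // (Z i j 1) // (Z j k 0) // (Z j k 1) // !mul0r !add0r.
move=> i j pi pj; have := E i j 2 2; rewrite !sum_ord3 pi expr0 mul1r.
have Z r s t : par t = par r (+) par s -> d (r, s) 0 t = 0.
  by move=> pt; rewrite (codifferential_odd dd) // pt.
by rewrite (Z i j 0) ?pi ?pj // (Z i j 1) ?pi ?pj // (Z j 2 2) ?pj // !mul0r !add0r addr0.
Qed.

Lemma codifferential_formP d u : codifferential d -> u * d (1, 1) 0 2 = 1 ->
  (exists w, w * (d (0, 1) 0 2 - d (1, 0) 0 2) = 1) \/
  (exists w, w * (d (0, 1) 0 2 ^+ 2 - d (0, 0) 0 2 * d (1, 1) 0 2) = 1) ->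
  d = form_cochain (d (0, 0) 0 2) (d (0, 1) 0 2) (d (1, 0) 0 2) (d (1, 1) 0 2).
Proof.
move=> dd u1 dw; have [E1 E2] := codifferential_equations dd.
have uK x : d (1, 1) 0 2 * x = 0 -> x = 0.
  by move=> e; rewrite -[x]mul1r -u1 -mulrA e mulr0.
have C1 l : par l = false -> d (2, 1) 0 l = - d (1, 2) 0 l.
  move=> pl; apply/eqP; rewrite -addr_eq0; apply/eqP/uK.
  by rewrite mulrDr E1.
have B1 l : par l = false -> d (1, 2) 0 l = 0.
  move=> pl; case: dw => -[w w1].
    rewrite -[LHS]mul1r -w1 -mulrA.
    have := E1 1 0 1 l erefl erefl erefl pl; rewrite C1 // => e.
    by rewrite -[RHS](mulr0 w) -e; ring.
  rewrite -[LHS]mul1r -w1 -mulrA.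
  (* The combination a22 [e1] - a12 [e2] eliminates d(v_1, v_3) and leaves (a12^2 - a11 a22) d(v_2,
     v_3). *)
  have e1 := E1 0 0 1 l erefl erefl erefl pl.
  have e2 := E1 0 1 1 l erefl erefl erefl pl.
  rewrite C1 // in e1 e2.
  transitivity (w * (d (1, 1) 0 2 * (d (0, 0) 0 2 * - d (1, 2) 0 l +
      d (0, 1) 0 2 * d (0, 2) 0 l) -
    d (0, 1) 0 2 * (d (0, 1) 0 2 * - d (1, 2) 0 l + d (1, 1) 0 2 * d (0, 2) 0 l))).
    by ring.
  by rewrite e1 e2; ring.
have C1' l : par l = false -> d (2, 1) 0 l = 0 by move=> pl; rewrite C1 // B1 // oppr0.
have C0 l : par l = false -> d (2, 0) 0 l = 0.
  by move=> pl; apply: uK; have := E1 1 1 0 l erefl erefl erefl pl; rewrite B1 // mulr0 addr0.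
have B0 l : par l = false -> d (0, 2) 0 l = 0.
  by move=> pl; apply: uK; have := E1 0 1 1 l erefl erefl erefl pl; rewrite C1' // mulr0 add0r.
have e0 : d (2, 2) 0 2 = 0.
  by apply: uK; have := E2 1 1 erefl erefl; rewrite !B1 // !mul0r !addr0.
apply/ffunP => -[i j]; apply/rowP => l.
have := codifferential_odd (i := i) (j := j) (l := l) dd.
rewrite form_cochainE; move: i j l; do 3!apply: forall_ord3; rewrite /= => Z;
  first [ring | rewrite Z //; ring | rewrite ?B0 ?B1 ?C0 ?C1' ?e0 //; ring].
Qed.

(** With a12 = 0 the triples (v_2, v_1, v_2) and (v_1, v_1, v_2) say that a21 and a11 annihilate
    d(v_2, v_3), whose components turn out to be [- t1] and [- t2]: these are the four relations. *)
Lemma codifferential_planeP d (t1 := - d (1, 2) 0 0) (t2 := d (2, 2) 0 2)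
    (t3 := d (1, 0) 0 2) (t4 := d (0, 0) 0 2) :
  codifferential d -> d (1, 1) 0 2 = 1 -> d (0, 1) 0 2 = 0 ->
  [/\ d = plane_cochain t1 t2 t3 t4,
      t1 * t3 = 0, t1 * t4 = 0, t2 * t3 = 0 & t2 * t4 = 0].
Proof.
move=> dd a22 a12; have [E1 E2] := codifferential_equations dd.
have C1 l : par l = false -> d (2, 1) 0 l = - d (1, 2) 0 l.
  move=> pl; apply/eqP; rewrite -addr_eq0; apply/eqP.
  by have := E1 1 1 1 l erefl erefl erefl pl; rewrite a22 !mul1r.
have B0 l : par l = false -> d (0, 2) 0 l = 0.
  by move=> pl; have := E1 0 1 1 l erefl erefl erefl pl; rewrite a22 a12 mul0r mul1r add0r.
have B1a l : par l = false -> d (1, 0) 0 2 * d (1, 2) 0 l = 0.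
  move=> pl; have := E1 1 0 1 l erefl erefl erefl pl; rewrite C1 // a12 mul0r addr0 mulrN.
  by move/eqP; rewrite oppr_eq0 => /eqP.
have B1b l : par l = false -> d (0, 0) 0 2 * d (1, 2) 0 l = 0.
  move=> pl; have := E1 0 0 1 l erefl erefl erefl pl; rewrite C1 // a12 mul0r addr0 mulrN.
  by move/eqP; rewrite oppr_eq0 => /eqP.
have C0 l : par l = false -> d (2, 0) 0 l = 0.
  by move=> pl; have := E1 1 1 0 l erefl erefl erefl pl; rewrite a22 mul1r B1a // addr0.
have e1 : t2 = - d (1, 2) 0 1.
  apply/eqP; rewrite -addr_eq0; apply/eqP.
  have := E2 1 1 erefl erefl; rewrite a22 mul1r mulr1 mulrC.
  by rewrite B1a // add0r.
have B11 : d (1, 2) 0 1 = - t2 by rewrite e1 opprK.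
have B10 : d (1, 2) 0 0 = - t1 by rewrite opprK.
split; last 4 first.
- by rewrite mulNr mulrC B1a ?oppr0.
- by rewrite mulNr mulrC B1b ?oppr0.
- by rewrite e1 mulNr mulrC B1a ?oppr0.
- by rewrite e1 mulNr mulrC B1b ?oppr0.
apply/ffunP => -[i j]; apply/rowP => l; rewrite plane_cochainE.
have := codifferential_odd (i := i) (j := j) (l := l) dd.
move: i j l; do 3!apply: forall_ord3; rewrite /= => Z;
  first [done | by rewrite Z | by rewrite ?B0 ?C1 ?C0 ?a22 ?a12 ?B10 ?B11 ?opprK].
Qed.

End NormalForms.

(** * Block matrices and congruence of forms *)

Section Conjugation.
Variable A : comNzRingType.
Implicit Types d : cochain A.

Definition block_mx3 (g11 g12 g21 g22 c : A) : 'M[A]_3 :=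
  \matrix_(i, j) nth 0 (nth [::] [:: [:: g11; g12; 0]; [:: g21; g22; 0]; [:: 0; 0; c]] i) j.

Lemma block_mx3_even g11 g12 g21 g22 c : even_mx (block_mx3 g11 g12 g21 g22 c).
Proof. by move=> i j; rewrite mxE; move: i j; do 2!apply: forall_ord3. Qed.

Lemma block_mx3M g11 g12 g21 g22 c h11 h12 h21 h22 e :
  block_mx3 g11 g12 g21 g22 c *m block_mx3 h11 h12 h21 h22 e =
  block_mx3 (g11 * h11 + g12 * h21) (g11 * h12 + g12 * h22)
            (g21 * h11 + g22 * h21) (g21 * h12 + g22 * h22) (c * e).
Proof.
apply/matrixP => i j; rewrite !mxE sum_ord3 !mxE; move: i j.
by do 2!apply: forall_ord3; rewrite /=; ring.
Qed.

Lemma block_mx3_1 : block_mx3 1 0 0 1 1 = 1%:M.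
Proof. by apply/matrixP => i j; rewrite !mxE; move: i j; do 2!apply: forall_ord3. Qed.

Lemma block_mx3_inv g11 g12 g21 g22 c D c' :
  D * (g11 * g22 - g12 * g21) = 1 -> c' * c = 1 ->
  let g := block_mx3 g11 g12 g21 g22 c in
  let h := block_mx3 (D * g22) (- (D * g12)) (- (D * g21)) (D * g11) c' in
  g *m h = 1%:M /\ h *m g = 1%:M.
Proof.
move=> D1 c1 /=; rewrite !block_mx3M -block_mx3_1.
by split; congr block_mx3; first [ring | rewrite -D1; ring | rewrite -c1; ring].
Qed.

Lemma conjugate_by_coefP d d' (g h : 'M[A]_3) : g *m h = 1%:M -> h *m g = 1%:M ->
  (forall i j l, \sum_k d' (i, j) 0 k * g k l =
    \sum_k \sum_r g i k * g j r * d (k, r) 0 l) -> conjugate_by g d d'.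
Proof.
move=> gh hg dd'; exists h; split=> //; apply/conjugate_byP => // i j.
apply/rowP => l; rewrite mxE dd' summxE; apply: eq_bigr => k _.
by rewrite summxE; apply: eq_bigr => r _; rewrite !mxE.
Qed.

Lemma conjugate_by_form d d' (g : 'M[A]_3) i j : even_mx g -> conjugate_by g d d' ->
  par i = false -> par j = false ->
  d' (i, j) 0 2 * g 2 2 =
    g i 0 * g j 0 * d (0, 0) 0 2 + g i 0 * g j 1 * d (0, 1) 0 2 +
    (g i 1 * g j 0 * d (1, 0) 0 2 + g i 1 * g j 1 * d (1, 1) 0 2).
Proof.
move=> ge /(conjugate_by_coef i j 2) + pi pj; rewrite !sum_ord3.
rewrite (ge i 2) ?pi // (ge j 2) ?pj // (ge 0 2) // (ge 1 2) // => e.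
by rewrite -[LHS]add0r -[X in X + _](mulr0 (d' (i, j) 0 0 + d' (i, j) 0 1)) mulrDl e; ring.
Qed.

Lemma form_conjugate g11 g12 g21 g22 c D c' a11 a12 a21 a22 b11 b12 b21 b22 :
  D * (g11 * g22 - g12 * g21) = 1 -> c' * c = 1 ->
  b11 * c = g11 * g11 * a11 + g11 * g12 * a12 + (g12 * g11 * a21 + g12 * g12 * a22) ->
  b12 * c = g11 * g21 * a11 + g11 * g22 * a12 + (g12 * g21 * a21 + g12 * g22 * a22) ->
  b21 * c = g21 * g11 * a11 + g21 * g12 * a12 + (g22 * g11 * a21 + g22 * g12 * a22) ->
  b22 * c = g21 * g21 * a11 + g21 * g22 * a12 + (g22 * g21 * a21 + g22 * g22 * a22) ->
  conjugate_by (block_mx3 g11 g12 g21 g22 c)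
    (form_cochain a11 a12 a21 a22) (form_cochain b11 b12 b21 b22).
Proof.
move=> D1 c1 e11 e12 e21 e22; have [gh hg] := block_mx3_inv D1 c1.
apply: (conjugate_by_coefP gh hg) => i j l; rewrite !sum_ord3 !form_cochainE !mxE.
move: i j l; do 3!apply: forall_ord3; rewrite /=.
all: first [ring
  | transitivity (b11 * c); [ring | rewrite e11; ring]
  | transitivity (b12 * c); [ring | rewrite e12; ring]
  | transitivity (b21 * c); [ring | rewrite e21; ring]
  | transitivity (b22 * c); [ring | rewrite e22; ring]].
Qed.

End Conjugation.

Section Shear.
Variables (K : fieldType) (d : cochain K).
Variables (B : comAlgType K) (eps : {lrmorphism B -> K | *%R}).

Lemma map_block_mx3 (C D : comNzRingType) (f : {rmorphism C -> D}) g11 g12 g21 g22 c :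
  map_mx f (block_mx3 g11 g12 g21 g22 c) =
  block_mx3 (f g11) (f g12) (f g21) (f g22) (f c).
Proof.
apply/matrixP => i j; rewrite !mxE; move: i j.
by do 2!apply: forall_ord3; rewrite //= rmorph0.
Qed.

Lemma aug_block_mx3 g11 g12 g21 g22 c : eps g11 = 1 -> eps g12 = 0 -> eps g21 = 0 ->
  eps g22 = 1 -> eps c = 1 -> map_mx eps (block_mx3 g11 g12 g21 g22 c) = 1%:M.
Proof. by rewrite map_block_mx3 -block_mx3_1 /= => -> -> -> -> ->. Qed.

(** The entries stay multiplied by [c], so no inverse occurs in the formulas. With [c] the entry a22
    of [dB], the new a22 becomes 1, while [x] and [s] are left to normalise the other entries. *)
Lemma shear_deformation dB s s' x c c' : odd_cochain d -> deformation d eps dB ->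
  s' * s = 1 -> c' * c = 1 -> eps s = 1 -> eps c = 1 -> eps x = 0 ->
  exists d', [/\ deformation d eps d', equivalent_deformations eps d' dB,
    d' (0, 0) 0 2 * c = s * s * (dB (0, 0) 0 2 + x * (dB (0, 1) 0 2 + dB (1, 0) 0 2)
      + x * x * dB (1, 1) 0 2),
    d' (0, 1) 0 2 * c = s * (dB (0, 1) 0 2 + x * dB (1, 1) 0 2) &
    d' (1, 0) 0 2 * c = s * (dB (1, 0) 0 2 + x * dB (1, 1) 0 2) /\
    d' (1, 1) 0 2 * c = dB (1, 1) 0 2].
Proof.
move=> dodd def s1 c1 es ec ex.
have D1 : s' * (s * 1 - (s * x) * 0) = 1 by transitivity (s' * s); first ring.
have [gh hg] := block_mx3_inv D1 c1; set g := block_mx3 s _ _ _ _ in gh hg.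
have ge : even_mx g by apply: block_mx3_even.
have gm : map_mx eps g = 1%:M.
  by apply: aug_block_mx3; rewrite ?rmorph0 ?rmorph1 // rmorphM /= ex mulr0.
set h := block_mx3 _ _ _ _ c' in gh hg.
have [def' eq'] := deformation_conj dodd def ge gm gh hg.
have F i j := conjugate_by_form (i := i) (j := j) ge (conj_cochainP dB gh hg).
exists (conj_cochain g h dB).
have g22 : g 2 2 = c by rewrite mxE.
have g00 : g 0 0 = s by rewrite mxE.
have g01 : g 0 1 = s * x by rewrite mxE.
have g10 : g 1 0 = 0 by rewrite mxE.
have g11 : g 1 1 = 1 by rewrite mxE.
by split=> //; [| | split]; rewrite -g22 F // ?g00 ?g01 ?g10 ?g11; ring.
Qed.

Lemma infinitesimal_mulr a y : infinitesimal eps -> aug_ideal eps y ->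
  a * y = eps a *: y.
Proof.
move=> inf my; apply/eqP; rewrite -subr_eq0 -mulr_algl -mulrBl; apply/eqP/inf.
apply: ideal_pow_mulS; first exact: aug_idealB.
by apply/ideal_pow1 => //; apply: aug_ideal_ideal.
Qed.

(* To first order the deformations of d change by the coboundary of lam. *)
Lemma infinitesimal_equivalence dA dA' : infinitesimal eps ->
  cochain_map eps dA = d -> cochain_map eps dA' = d ->
  equivalent_deformations eps dA dA' ->
  exists lam : 'M[B]_3, even_mx lam /\ forall i j l,
    dA' (i, j) 0 l - dA (i, j) 0 l =
      \sum_k d (k, j) 0 l *: lam i k + \sum_k d (i, k) 0 l *: lam j k
      - \sum_k d (i, j) 0 k *: lam k l.
Proof.
move=> inf eA eA' [lam [le lm c]]; exists lam; split=> // i j l.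
have dE (D : cochain B) a b l' : cochain_map eps D = d ->
    eps (D (a, b) 0 l') = d (a, b) 0 l'.
  by move=> <-; rewrite ffunE mxE.
have mul0 a b c' e : lam a b * lam c' e = 0.
  by rewrite infinitesimal_mulr // lm scale0r.
have eq := conjugate_by_coef i j l c.
have idE (F : 'I_3 -> B) a : \sum_k F k * (1%:M + lam) k a = F a + \sum_k F k * lam k a.
  under eq_bigr do rewrite mxE mulrDr.
  rewrite big_split; congr (_ + _); rewrite (bigD1 a) //= mxE eqxx mulr1.
  by rewrite big1 ?addr0 // => k ka; rewrite mxE (negPf ka) mulr0.
have idE' (F : 'I_3 -> B) a : \sum_k (1%:M + lam) a k * F k = F a + \sum_k lam a k * F k.
  under eq_bigr do rewrite mxE mulrDl.
  rewrite big_split; congr (_ + _); rewrite (bigD1 a) //= mxE eqxx mul1r.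
  by rewrite big1 ?addr0 // => k ka; rewrite mxE eq_sym (negPf ka) mul0r.
have e1 : \sum_k dA' (i, j) 0 k * lam k l = \sum_k d (i, j) 0 k *: lam k l.
  by apply: eq_bigr => k _; rewrite infinitesimal_mulr ?dE.
have e2 : \sum_k lam i k * dA (k, j) 0 l = \sum_k d (k, j) 0 l *: lam i k.
  by apply: eq_bigr => k _; rewrite mulrC infinitesimal_mulr ?dE.
have e3 : \sum_k lam j k * dA (i, k) 0 l = \sum_k d (i, k) 0 l *: lam j k.
  by apply: eq_bigr => k _; rewrite mulrC infinitesimal_mulr ?dE.
(* The terms quadratic in [lam] vanish because the kernel has square zero. *)
have e4 : \sum_k \sum_r (1%:M + lam) i k * (1%:M + lam) j r * dA (k, r) 0 l =
    dA (i, j) 0 l + \sum_k lam j k * dA (i, k) 0 l + \sum_k lam i k * dA (k, j) 0 l.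
  have -> : \sum_k \sum_r (1%:M + lam) i k * (1%:M + lam) j r * dA (k, r) 0 l =
      \sum_k (1%:M + lam) i k * (dA (k, j) 0 l + \sum_r lam j r * dA (k, r) 0 l).
    apply: eq_bigr => k _; rewrite -(idE' (fun r => dA (k, r) 0 l)) mulr_sumr.
    by apply: eq_bigr => r _; rewrite mulrA.
  rewrite (idE' (fun k => dA (k, j) 0 l + \sum_r lam j r * dA (k, r) 0 l)).
  congr (_ + _); apply: eq_bigr => k _; rewrite mulrDr mulr_sumr.
  by rewrite big1 ?addr0 // => r _; rewrite mulrA mul0 mul0r.
move: eq; rewrite idE e4 e1 e2 e3 => /(canRL (addrK _)) ->; ring.
Qed.

End Shear.

(** * Miniversal deformations *)

Section Miniversal.
Variable K : fieldType.

Lemma form_cochain_odd (A : comNzRingType) (a11 a12 a21 a22 : A) :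
  odd_cochain (form_cochain a11 a12 a21 a22).
Proof. by case: (codifferential_form a11 a12 a21 a22). Qed.

Lemma cochain_map_form (A B : comNzRingType) (f : {rmorphism A -> B}) a11 a12 a21 a22 :
  cochain_map f (form_cochain a11 a12 a21 a22) =
  form_cochain (f a11) (f a12) (f a21) (f a22).
Proof. by rewrite /form_cochain !cochain_mapE. Qed.

Lemma deformation_form (B : comAlgType K) (eps : {lrmorphism B -> K | *%R})
    a11 a12 a21 a22 b11 b12 b21 b22 :
  eps b11 = a11 -> eps b12 = a12 -> eps b21 = a21 -> eps b22 = a22 ->
  deformation (form_cochain a11 a12 a21 a22) eps (form_cochain b11 b12 b21 b22).
Proof.
move=> <- <- <- <-; apply/deformationP; first exact: form_cochain_odd.
by split; [exact: codifferential_form | rewrite (cochain_map_form eps)].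
Qed.

Lemma deformation_coef d (B : comAlgType K) (eps : {lrmorphism B -> K | *%R}) dB i j l :
  odd_cochain d -> deformation d eps dB -> eps (dB (i, j) 0 l) = d (i, j) 0 l.
Proof. by move=> dodd /(deformationP _ _ dodd)[_ <-]; rewrite ffunE mxE. Qed.

Lemma complete_inv_aug (B : comAlgType K) (eps : {lrmorphism B -> K | *%R}) b c :
  is_complete (aug_ideal eps) -> eps b = c -> c != 0 ->
  exists2 y, y * b = 1 & eps y = c^-1.
Proof.
move=> cB eb c0; have [|y yb] := complete_inv cB (x := b); first by rewrite eb.
exists y => //; apply: (mulIf c0); rewrite mulVf // -eb -rmorphM /= yb.
exact: rmorph1.
Qed.

Lemma infinitesimal_form (B : comAlgType K) (eps : {lrmorphism B -> K | *%R})
    a11 a12 a21 a22 (b11 b12 b21 b22 b11' b12' b21' b22' : B) :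
  infinitesimal eps ->
  eps b11 = a11 -> eps b12 = a12 -> eps b21 = a21 -> eps b22 = a22 ->
  eps b11' = a11 -> eps b12' = a12 -> eps b21' = a21 -> eps b22' = a22 ->
  equivalent_deformations eps (form_cochain b11 b12 b21 b22)
    (form_cochain b11' b12' b21' b22') ->
  exists l11 l12 l21 l22 l33,
    [/\ b11' - b11 = a11 *: l11 + a21 *: l12 + (a11 *: l11 + a12 *: l12) - a11 *: l33,
        b12' - b12 = a12 *: l11 + a22 *: l12 + (a11 *: l21 + a12 *: l22) - a12 *: l33 &
        b21' - b21 = a11 *: l21 + a21 *: l22 + (a21 *: l11 + a22 *: l12) - a21 *: l33].
Proof.
move=> inf e11 e12 e21 e22 e11' e12' e21' e22' eqv.
have m1 : cochain_map eps (form_cochain b11 b12 b21 b22) = form_cochain a11 a12 a21 a22.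
  by rewrite (cochain_map_form eps) /= e11 e12 e21 e22.
have m2 : cochain_map eps (form_cochain b11' b12' b21' b22') = form_cochain a11 a12 a21 a22.
  by rewrite (cochain_map_form eps) /= e11' e12' e21' e22'.
have [lam [_ L]] := infinitesimal_equivalence inf m1 m2 eqv.
have E (i j : 'I_3) : form_coef b11' b12' b21' b22' i j (2%R : 'I_3) -
    form_coef b11 b12 b21 b22 i j (2%R : 'I_3) =
    \sum_(k < 3) form_coef a11 a12 a21 a22 k j (2%R : 'I_3) *: lam i k +
    \sum_(k < 3) form_coef a11 a12 a21 a22 i k (2%R : 'I_3) *: lam j k -
    \sum_(k < 3) form_coef a11 a12 a21 a22 i j k *: lam k 2.
  rewrite -!form_cochainE L; congr (_ + _ - _); apply: eq_bigr => k _;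
  by rewrite form_cochainE.
exists (lam 0 0), (lam 0 1), (lam 1 0), (lam 1 1), (lam 2 2).
by split; [have := E 0 0 | have := E 0 1 | have := E 1 0];
  rewrite !sum_ord3 /= !scale0r !(addr0, add0r).
Qed.

(** A morphism from the series in one variable is the choice of an element [t] of the kernel. With
    [F] compatible with morphisms, versality becomes reaching every deformation by some [F B t], and
    uniqueness the injectivity of [F] up to equivalence over infinitesimal bases. *)
Lemma miniversal_line (d : cochain K) (F : forall A : comAlgType K, A -> cochain A) :
  (forall (A : comAlgType K) (eps : {lrmorphism A -> K | *%R}) (t : A),
     aug_ideal eps t -> deformation d eps (F A t)) ->
  (forall (A B : comAlgType K) (f : {lrmorphism A -> B}) (t : A),
     cochain_map f (F A t) = F B (f t)) ->
  (forall (B : comAlgType K) (eps : {lrmorphism B -> K | *%R}) dB,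
     is_complete (aug_ideal eps) -> deformation d eps dB ->
     exists2 t, aug_ideal eps t & equivalent_deformations eps (F B t) dB) ->
  (forall (B : comAlgType K) (eps : {lrmorphism B -> K | *%R}) (t t' : B),
     infinitesimal eps -> aug_ideal eps t -> aug_ideal eps t' ->
     equivalent_deformations eps (F B t) (F B t') -> t = t') ->
  miniversal d (ps_aug K 1) (F _ (psvar K ord0)).
Proof.
move=> Fdef Fmap Fversal Finj; split.
  split; [exact: pseries_formal_base | by apply: Fdef; exact: psvar_const |].
  move=> B eps dB [_ _ cB] defB; have [t mt eqt] := Fversal B eps dB cB defB.
  have [f [fe fv]] := ps_subst_exists (n := 1) cB (tau := fun=> t) (fun=> mt).
  by exists f; split=> //; rewrite Fmap fv.
move=> B eps dB [_ _ cB] inf defB f g [fe eqf] [ge eqg].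
have mf : aug_ideal eps (f (psvar K ord0)).
  by rewrite /aug_ideal fe; exact: psvar_const.
have mg : aug_ideal eps (g (psvar K ord0)).
  by rewrite /aug_ideal ge; exact: psvar_const.
have fg : f (psvar K ord0) = g (psvar K ord0).
  apply: (Finj B eps) => //; rewrite -!Fmap.
  exact: equivalent_deformations_trans eqf (equivalent_deformations_sym eqg).
apply: (ps_morphism_unique cB (tau := fun=> f (psvar K ord0))) => // i.
  by rewrite ord1.
by rewrite ord1.
Qed.

(** One of the two annihilators of d(v_2, v_3) is a unit because its augmentation is: [q - p] if
    this is nonzero, and otherwise [q ^+ 2]. *)
Lemma deformation_is_form (p q : K) (B : comAlgType K)
    (eps : {lrmorphism B -> K | *%R}) d' :
  is_complete (aug_ideal eps) -> deformation (form_cochain 0 q p 1) eps d' ->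
  q != p \/ q != 0 ->
  d' = form_cochain (d' (0, 0) 0 2) (d' (0, 1) 0 2) (d' (1, 0) 0 2) (d' (1, 1) 0 2).
Proof.
move=> cB def' pq; have dodd := form_cochain_odd 0 q p 1.
have [dd' _] := proj1 (deformationP _ _ dodd) def'.
have E i j : eps (d' (i, j) 0 2) = form_coef 0 q p 1 i j 2.
  by rewrite (deformation_coef i j 2 dodd def') form_cochainE.
have [u u1 _] := complete_inv_aug cB (E 1 1) (oner_neq0 _).
apply: (codifferential_formP dd' u1).
have [qp|qp] := eqVneq q p; [right|left].
  have [||w w1 _] := @complete_inv_aug _ eps
     (d' (0, 1) 0 2 ^+ 2 - d' (0, 0) 0 2 * d' (1, 1) 0 2) (q ^+ 2) cB.
  - by rewrite rmorphB rmorphXn rmorphM /= !E mul0r subr0.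
  - by rewrite expf_neq0 //; case: pq => //; rewrite qp eqxx.
  by exists w.
have [||w w1 _] := @complete_inv_aug _ eps (d' (0, 1) 0 2 - d' (1, 0) 0 2) (q - p) cB.
- by rewrite rmorphB /= !E.
- by rewrite subr_eq0.
by exists w.
Qed.

(* Away from p + q = 0 the second isotropic vector is found by Hensel's lemma. *)
Lemma miniversal_d13 p q : q != 0 -> p + q != 0 ->
  miniversal (d13 p q) (ps_aug K 1) (d13 (p%:A + psvar K ord0) q%:A).
Proof.
move=> q0 pq0; pose F (A : comAlgType K) (t : A) := form_cochain 0 q%:A (p%:A + t) 1.
rewrite !d13E -/(F _ _); apply: (@miniversal_line _ F).
- move=> A eps t mt; apply: deformation_form; rewrite ?rmorph0 ?rmorph1 ?aug_scale //.
  by rewrite rmorphD /= mt addr0 aug_scale.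
- move=> A B f t; rewrite cochain_map_form rmorph0 rmorph1 rmorphD /= !linearZ /=.
  by rewrite !rmorph1.
- move=> B eps dB cB defB; have dodd := form_cochain_odd 0 q p 1.
  have E i j := deformation_coef i j 2 dodd defB.
  have e00 : eps (dB (0, 0) 0 2) = 0 by rewrite E form_cochainE.
  have e01 : eps (dB (0, 1) 0 2) = q by rewrite E form_cochainE.
  have e10 : eps (dB (1, 0) 0 2) = p by rewrite E form_cochainE.
  have e11 : eps (dB (1, 1) 0 2) = 1 by rewrite E form_cochainE.
  have {E} [|x mx xE] := @complete_quadratic _ _ eps cB (dB (1, 1) 0 2)
    (dB (0, 1) 0 2 + dB (1, 0) 0 2) (dB (0, 0) 0 2) _ e00.
    by rewrite rmorphD /= e01 e10 addrC.
  have [y yE ey] : exists2 y, y * (dB (0, 1) 0 2 + x * dB (1, 1) 0 2) = 1 & eps y = q^-1.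
    by apply: complete_inv_aug => //; rewrite rmorphD rmorphM /= mx mul0r addr0.
  have [c' c1 _] := complete_inv_aug cB e11 (oner_neq0 _).
  (* The scaling q a22 / (a12 + x a22) of v_1 is the one that brings a12 to [q] after the division
     by a22. *)
  have es : eps (q%:A * dB (1, 1) 0 2 * y) = 1.
    by rewrite !rmorphM /= aug_scale e11 ey mulr1 mulfV.
  have [s' s1 _] := complete_inv_aug cB es (oner_neq0 _).
  have [d' [def' eq' E00 E01 [_ E11]]] := shear_deformation dodd defB s1 c1 es e11 mx.
  have cK (a b : B) : a * dB (1, 1) 0 2 = b * dB (1, 1) 0 2 -> a = b.
    by move=> e; rewrite -[a]mulr1 -[b]mulr1 -c1 mulrCA e mulrCA.
  have d11 : d' (1, 1) 0 2 = 1 by apply: cK; rewrite E11 mul1r.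
  have d01 : d' (0, 1) 0 2 = q%:A.
    by apply: cK; rewrite E01 -[LHS]mulrA yE mulr1.
  have d00 : d' (0, 0) 0 2 = 0.
    set s := q%:A * _ * y in E00.
    by apply: cK; rewrite E00 mul0r -[RHS](mulr0 (s * s)) -xE; congr (_ * _); ring.
  have e' : eps (d' (1, 0) 0 2) = p.
    by rewrite (deformation_coef _ _ _ dodd def') form_cochainE.
  exists (d' (1, 0) 0 2 - p%:A).
    by rewrite /aug_ideal rmorphB /= aug_scale e' subrr.
  rewrite /F addrC subrK.
  by move: (deformation_is_form cB def' (or_intror q0)); rewrite d00 d01 d11 => <-.
move=> B eps t t' inf mt mt' eqt.
have [||||||||l11 [l12 [l21 [l22 [l33 [L00 L01 L10]]]]]] :=
  infinitesimal_form (a11 := 0) (a12 := q) (a21 := p) (a22 := 1) inf _ _ _ _ _ _ _ _ eqt;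
  rewrite ?rmorph0 ?rmorph1 ?aug_scale ?rmorphD /= ?mt ?mt' ?aug_scale ?addr0 //.
rewrite !scale0r ?scale1r in L00 L01 L10.
(* Keeping v_1 isotropic forbids a shear to first order, as [p + q] is nonzero; keeping a12 = [q]
   then fixes the scaling, and with it a21. *)
have y0 : l12 = 0.
  have : (p + q) *: l12 = 0.
    by rewrite scalerDl -[LHS]subr0 -[RHS](subrr 0) L00; ring.
  by move/eqP; rewrite scaler_eq0 (negPf pq0) => /eqP.
have z0 : l11 + l22 - l33 = 0.
  have : q *: (l11 + l22 - l33) = 0.
    by rewrite -[RHS](subrr q%:A) L01 y0 scalerBr scalerDr; ring.
  by move/eqP; rewrite scaler_eq0 (negPf q0) => /eqP.
apply/eqP; rewrite eq_sym -subr_eq0; apply/eqP.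
transitivity (p%:A + t' - (p%:A + t)); first by ring.
have pz : p *: l11 + p *: l22 - p *: l33 = 0.
  by rewrite -scalerDr -scalerBr z0 scaler0.
by rewrite L10 y0 -[RHS]pz; ring.
Qed.

(** As q = 0, the entry a12 cannot be scaled to a unit; the shear x = - a12 / a22 makes it zero
    instead, a21 is scaled to 1, and a11 remains as the parameter. *)
Lemma miniversal_d13_10 :
  miniversal (d13 1 0) (ps_aug K 1) (d13 1 0 + psvar K ord0 *: psi 1 1 3).
Proof.
pose F (A : comAlgType K) (t : A) := form_cochain t 0 1 1.
have FE (A : comNzRingType) (t : A) : d13 1 0 + t *: psi 1 1 3 = form_cochain t 0 1 1.
  by cochain_eq; ring.
rewrite FE d13E -/(F _ _); apply: (@miniversal_line _ F).
- by move=> A eps t mt; apply: deformation_form; rewrite ?rmorph0 ?rmorph1.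
- by move=> A B f t; rewrite cochain_map_form rmorph0 rmorph1.
- move=> B eps dB cB defB; have dodd := form_cochain_odd (0 : K) 0 1 1.
  have E i j : eps (dB (i, j) 0 2) = form_coef 0 0 1 1 i j 2.
    by rewrite (deformation_coef i j 2 dodd defB) form_cochainE.
  have [c' c1 ec'] := complete_inv_aug cB (E 1 1) (oner_neq0 _).
  have ex : eps (- (c' * dB (0, 1) 0 2)) = 0.
    by rewrite rmorphN rmorphM /= E mulr0 oppr0.
  have xE : - (c' * dB (0, 1) 0 2) * dB (1, 1) 0 2 = - dB (0, 1) 0 2.
    by rewrite mulNr mulrAC c1 mul1r.
  set x := - (c' * _) in ex xE.
  have [y yE ey] : exists2 y, y * (dB (1, 0) 0 2 + x * dB (1, 1) 0 2) = 1 & eps y = 1^-1.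
    apply: complete_inv_aug (oner_neq0 _) => //.
    by rewrite rmorphD rmorphM /= ex mul0r addr0 E.
  have es : eps (dB (1, 1) 0 2 * y) = 1 by rewrite rmorphM /= E ey mul1r invr1.
  have [s' s1 _] := complete_inv_aug cB es (oner_neq0 _).
  have [d' [def' eq' _ E01 [E10 E11]]] :=
    shear_deformation dodd defB s1 c1 es (E 1 1) ex.
  have cK (a b : B) : a * dB (1, 1) 0 2 = b * dB (1, 1) 0 2 -> a = b.
    by move=> e; rewrite -[a]mulr1 -[b]mulr1 -c1 mulrCA e mulrCA.
  have d11 : d' (1, 1) 0 2 = 1 by apply: cK; rewrite E11 mul1r.
  have d10 : d' (1, 0) 0 2 = 1 by apply: cK; rewrite E10 -[LHS]mulrA yE mulr1 mul1r.
  have d01 : d' (0, 1) 0 2 = 0.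
    by apply: cK; rewrite E01 xE subrr mulr0 mul0r.
  exists (d' (0, 0) 0 2).
    by rewrite /aug_ideal (deformation_coef _ _ _ dodd def') form_cochainE.
  have qp : (0 : K) != 1 by rewrite eq_sym oner_neq0.
  by move: (deformation_is_form cB def' (or_introl qp)); rewrite d10 d01 d11 /F => <-.
move=> B eps t t' inf mt mt' eqt.
have [||||||||l11 [l12 [l21 [l22 [l33 [L00 L01 _]]]]]] :=
  infinitesimal_form (a11 := 0) (a12 := 0) (a21 := 1) (a22 := 1) inf _ _ _ _ _ _ _ _ eqt;
  rewrite ?rmorph0 ?rmorph1 //.
rewrite !scale0r ?scale1r in L00 L01.
apply/eqP; rewrite eq_sym -subr_eq0; apply/eqP; rewrite L00.
transitivity (l12); first ring.
by rewrite -[RHS](subrr 0) L01; ring.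
Qed.

(** As p + q = 0, the quadratic equation for an isotropic vector has a double root modulo the
    kernel, so Hensel's lemma fails. The shear by - (a12 + a21) / (2 a22) makes the off-diagonal
    part alternating instead. *)
Lemma miniversal_d13_1N1 : (2 : K) != 0 ->
  miniversal (d13 1 (-1)) (ps_aug K 1) (d13 1 (-1) + psvar K ord0 *: psi 1 1 3).
Proof.
move=> two0; pose F (A : comAlgType K) (t : A) := form_cochain t (-1) 1 1.
have FE (A : comNzRingType) (t : A) :
    d13 1 (-1) + t *: psi 1 1 3 = form_cochain t (-1) 1 1.
  by cochain_eq; ring.
rewrite FE d13E -/(F _ _); apply: (@miniversal_line _ F).
- by move=> A eps t mt; apply: deformation_form; rewrite ?rmorphN ?rmorph1.
- by move=> A B f t; rewrite cochain_map_form rmorphN rmorph1.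
- move=> B eps dB cB defB; have dodd := form_cochain_odd (0 : K) (-1) 1 1.
  have E i j : eps (dB (i, j) 0 2) = form_coef 0 (-1) 1 1 i j 2.
    by rewrite (deformation_coef i j 2 dodd defB) form_cochainE.
  have [c' c1 ec'] := complete_inv_aug cB (E 1 1) (oner_neq0 _).
  pose x := - (c' * (2^-1 *: (dB (0, 1) 0 2 + dB (1, 0) 0 2))).
  have ex : eps x = 0.
    by rewrite rmorphN rmorphM /= linearZ rmorphD /= !E addNr !mulr0 oppr0.
  have xE : x * dB (1, 1) 0 2 = - (2^-1 *: (dB (0, 1) 0 2 + dB (1, 0) 0 2)).
    by rewrite mulNr mulrAC c1 mul1r.
  have [y yE ey] : exists2 y, y * (dB (1, 0) 0 2 + x * dB (1, 1) 0 2) = 1 & eps y = 1^-1.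
    apply: complete_inv_aug (oner_neq0 _) => //.
    by rewrite rmorphD rmorphM /= ex mul0r addr0 E.
  have es : eps (dB (1, 1) 0 2 * y) = 1 by rewrite rmorphM /= E ey mul1r invr1.
  have [s' s1 _] := complete_inv_aug cB es (oner_neq0 _).
  have [d' [def' eq' _ E01 [E10 E11]]] :=
    shear_deformation dodd defB s1 c1 es (E 1 1) ex.
  have cK (a b : B) : a * dB (1, 1) 0 2 = b * dB (1, 1) 0 2 -> a = b.
    by move=> e; rewrite -[a]mulr1 -[b]mulr1 -c1 mulrCA e mulrCA.
  have d11 : d' (1, 1) 0 2 = 1 by apply: cK; rewrite E11 mul1r.
  have d10 : d' (1, 0) 0 2 = 1 by apply: cK; rewrite E10 -[LHS]mulrA yE mulr1 mul1r.
  have d01 : d' (0, 1) 0 2 = - 1.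
    have anti : dB (0, 1) 0 2 + x * dB (1, 1) 0 2 = - (dB (1, 0) 0 2 + x * dB (1, 1) 0 2).
      rewrite xE; set z := _ + dB (1, 0) 0 2; apply/eqP; rewrite -addr_eq0; apply/eqP.
      transitivity (z - ((2^-1 *: z) + (2^-1 *: z))); first by rewrite /z; ring.
      by rewrite -mulr2n -scaler_nat scalerA mulfV // scale1r subrr.
    by apply: cK; rewrite E01 anti -[LHS]mulrA mulrN yE mulN1r mulrN1.
  exists (d' (0, 0) 0 2).
    by rewrite /aug_ideal (deformation_coef _ _ _ dodd def') form_cochainE.
  have q0 : (-1 : K) != 0 by rewrite oppr_eq0 oner_neq0.
  by move: (deformation_is_form cB def' (or_intror q0)); rewrite d10 d01 d11 /F => <-.
move=> B eps t t' inf mt mt' eqt.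
have [||||||||l11 [l12 [l21 [l22 [l33 [L00 _ _]]]]]] :=
  infinitesimal_form (a11 := 0) (a12 := -1) (a21 := 1) (a22 := 1) inf _ _ _ _ _ _ _ _ eqt;
  rewrite ?rmorphN ?rmorph1 //.
rewrite !scale0r scale1r scaleN1r in L00.
by apply/eqP; rewrite eq_sym -subr_eq0; apply/eqP; rewrite L00; ring.
Qed.

Lemma cochain_map_plane (A B : comNzRingType) (f : {rmorphism A -> B}) t1 t2 t3 t4 :
  cochain_map f (plane_cochain t1 t2 t3 t4) =
  plane_cochain (f t1) (f t2) (f t3) (f t4).
Proof. by rewrite /plane_cochain /form_cochain !cochain_mapE rmorph0 rmorph1. Qed.

Lemma miniversal_d13_00 :
  miniversal (d13 0 0) (d13_00_eps K)
    (d13_00_inf (d13_00_var K 0) (d13_00_var K 1) (d13_00_var K 2) (d13_00_var K 3)).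
Proof.
have dE : d13 0 0 = plane_cochain 0 0 0 0 :> cochain K by rewrite d13E plane_cochain_form.
have rel (i j : 'I_4) : psvar K i * psvar K j \in d13_00_ideal K ->
    d13_00_var K i * d13_00_var K j = 0.
  move=> ij; rewrite -(rmorph0 (@d13_00_pi K)) -[d13_00_var K i]/(d13_00_pi _).
  rewrite -[d13_00_var K j]/(d13_00_pi _) -rmorphM; apply/d13_00_pi_eq.
  by rewrite subr0.
have Ig := @d13_00_ideal_gens _ (psvar K (0 : 'I_4)) (psvar K 1) (psvar K 2) (psvar K 3).
have h13 : d13_00_var K 0 * d13_00_var K 2 = 0 by apply/rel/Ig; rewrite inE eqxx.
have h14 : d13_00_var K 0 * d13_00_var K 3 = 0 by apply/rel/Ig; rewrite !inE eqxx ?orbT.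
have h23 : d13_00_var K 1 * d13_00_var K 2 = 0 by apply/rel/Ig; rewrite !inE eqxx ?orbT.
have h24 : d13_00_var K 1 * d13_00_var K 3 = 0 by apply/rel/Ig; rewrite !inE eqxx ?orbT.
have var0 i : aug_ideal (d13_00_eps K) (d13_00_var K i).
  by rewrite /aug_ideal [LHS]d13_00_augE psvar_const.
have dodd : odd_cochain (plane_cochain 0 0 0 0 : cochain K).
  by rewrite plane_cochain_form; exact: form_cochain_odd.
rewrite d13_00_infE // dE; split.
  split; first exact: complete_formal_base (d13_00_complete K).
    apply/(deformationP _ _ dodd); split; first exact: codifferential_plane.
    by rewrite (cochain_map_plane (d13_00_eps K)) /= !(var0 _).
  move=> B eps dB [_ _ cB] defB.
  have E i j : eps (dB (i, j) 0 2) = plane_coef 0 0 0 0 i j 2.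
    by rewrite (deformation_coef i j 2 dodd defB) plane_cochainE.
  have [c' c1 ec'] := complete_inv_aug cB (E 1 1) (oner_neq0 _).
  have ex : eps (- (c' * dB (0, 1) 0 2)) = 0.
    by rewrite rmorphN rmorphM /= E mulr0 oppr0.
  have xE : - (c' * dB (0, 1) 0 2) * dB (1, 1) 0 2 = - dB (0, 1) 0 2.
    by rewrite mulNr mulrAC c1 mul1r.
  set x := - (c' * _) in ex xE.
  have [d' [def' eq' _ E01 [_ E11]]] :=
    shear_deformation dodd defB (mulr1 1) c1 (rmorph1 eps) (E 1 1) ex.
  have cK (a b : B) : a * dB (1, 1) 0 2 = b * dB (1, 1) 0 2 -> a = b.
    by move=> e; rewrite -[a]mulr1 -[b]mulr1 -c1 mulrCA e mulrCA.
  have d11 : d' (1, 1) 0 2 = 1 by apply: cK; rewrite E11 mul1r.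
  have d01 : d' (0, 1) 0 2 = 0.
    by apply: cK; rewrite E01 xE subrr mulr0 mul0r.
  have [dd' _] := proj1 (deformationP _ _ dodd) def'.
  have [d'E r13 r14 r23 r24] := codifferential_planeP dd' d11 d01.
  have E' i j l : eps (d' (i, j) 0 l) = plane_coef 0 0 0 0 i j l.
    by rewrite (deformation_coef i j l dodd def') plane_cochainE.
  pose tau (i : 'I_4) : B := nth 0
    [:: - d' (1, 2) 0 0; d' (2, 2) 0 2; d' (1, 0) 0 2; d' (0, 0) 0 2] i.
  have [|f [fe fv]] := d13_00_morphism_exists (tau := tau) cB _ r13 r14 r23 r24.
    by move=> [[|[|[|[|//]]]] i4];
      rewrite /aug_ideal /tau /= ?rmorphN /= ?E' /= ?oppr0.
  exists f; split=> //; rewrite (cochain_map_plane f) /= !fv /tau /=.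
  by rewrite -d'E.
move=> B eps dB [_ _ cB] inf defB f g [fe eqf] [ge eqg].
have := equivalent_deformations_trans eqf (equivalent_deformations_sym eqg).
rewrite (cochain_map_plane f) (cochain_map_plane g) /= => eqfg.
have mf i : aug_ideal eps (f (d13_00_var K i)) by rewrite /aug_ideal fe; exact: var0.
have mg i : aug_ideal eps (g (d13_00_var K i)) by rewrite /aug_ideal ge; exact: var0.
have Fm (h : {lrmorphism d13_00_base K -> B}) :
  (forall i, aug_ideal eps (h (d13_00_var K i))) ->
  cochain_map eps (plane_cochain (h (d13_00_var K 0)) (h (d13_00_var K 1))
    (h (d13_00_var K 2)) (h (d13_00_var K 3))) = plane_cochain 0 0 0 0.
  by move=> hm; rewrite (cochain_map_plane eps) /= !hm.
have [lam [le L]] := infinitesimal_equivalence inf (Fm _ mf) (Fm _ mg) eqfg.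
apply: (d13_00_morphism_unique cB mf) => // i.
have L120 := L 1 2 0; have L222 := L 2 2 2; have L102 := L 1 0 2; have L002 := L 0 0 2.
have L012 := L 0 1 2.
rewrite !sum_ord3 !plane_cochainE /= in L120 L222 L102 L002 L012.
rewrite !oppr0 !scale0r ?scale1r in L120 L222 L102 L002 L012.
(* Both normal forms have a12 = 0, which excludes a shear; otherwise the third parameter would be
   determined only up to [lam 0 1]. *)
have l01 : lam 0 1 = 0 by rewrite -[RHS](addr0 0) L012; ring.
have sub0 (y z : B) : y - z = 0 -> y = z by move/eqP; rewrite subr_eq0 => /eqP.
move: i; apply: forall_ord4; apply: sub0.
- rewrite -[LHS]opprK; set y := - (_ - _).
  have -> : y = - g (d13_00_var K 0) - - f (d13_00_var K 0) by rewrite /y; ring.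
  by rewrite L120; ring.
- by rewrite L222; ring.
- by rewrite L102 l01; ring.
- by rewrite L002; ring.
Qed.

End Miniversal.

(** * Equivalences along the families *)

Section Equivalences.
Variable A : comNzRingType.

Lemma form_equivalent (g11 g12 g21 g22 c D c' a11 a12 a21 a22 b11 b12 b21 b22 : A) :
  D * (g11 * g22 - g12 * g21) = 1 -> c' * c = 1 ->
  b11 * c = g11 * g11 * a11 + g11 * g12 * a12 + (g12 * g11 * a21 + g12 * g12 * a22) ->
  b12 * c = g11 * g21 * a11 + g11 * g22 * a12 + (g12 * g21 * a21 + g12 * g22 * a22) ->
  b21 * c = g21 * g11 * a11 + g21 * g12 * a12 + (g22 * g11 * a21 + g22 * g12 * a22) ->
  b22 * c = g21 * g21 * a11 + g21 * g22 * a12 + (g22 * g21 * a21 + g22 * g22 * a22) ->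
  equivalent (form_cochain a11 a12 a21 a22) (form_cochain b11 b12 b21 b22).
Proof.
move=> D1 c1 e11 e12 e21 e22; exists (block_mx3 g11 g12 g21 g22 c).
by split; [exact: block_mx3_even | exact: form_conjugate D1 c1 e11 e12 e21 e22].
Qed.

(** The matrix preserves the line of v_1, the radical of the form [psi 2 2 3]; the condition
    [s * s = c] keeps the coefficient of that form equal to 1. *)
Lemma plane_equivalent (y z s c D c' t1 t2 b1 b2 : A) :
  D * (y * s) = 1 -> c' * c = 1 -> s * s = c ->
  b2 = c * t2 -> b1 * y + b2 * z = c * s * t1 ->
  equivalent (plane_cochain t1 t2 0 0) (plane_cochain b1 b2 0 0).
Proof.
move=> D1 c1 sc e2 e1; exists (block_mx3 y 0 z s c); split; first exact: block_mx3_even.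
have D1' : D * (y * s - 0 * z) = 1 by rewrite mul0r subr0.
have [gh hg] := block_mx3_inv D1' c1.
apply: (conjugate_by_coefP gh hg) => i j l; rewrite !sum_ord3 !plane_cochainE !mxE.
move: i j l; do 3!apply: forall_ord3; rewrite /=; first
  [ ring | rewrite -sc; ring | rewrite e2; ring
  | transitivity (b1 * y + b2 * z); [ring | rewrite e1; ring]
  | transitivity (- (b1 * y + b2 * z)); [ring | rewrite e1; ring]].
Qed.

Lemma even_conj_unit (d d' : cochain A) (g : 'M[A]_3) :
  even_mx g -> conjugate_by g d d' -> exists c', g 2 2 * c' = 1.
Proof.
move=> ge [h [gh _ _]]; exists (h 2 2); have := congr1 (fun M : 'M_3 => M 2 2) gh.
by rewrite !mxE sum_ord3 (ge 2 0) // (ge 2 1) // !mul0r !add0r.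
Qed.

Lemma conjugate_form_equations (g : 'M[A]_3) a11 a12 a21 a22 b11 b12 b21 b22 :
  even_mx g ->
  conjugate_by g (form_cochain a11 a12 a21 a22) (form_cochain b11 b12 b21 b22) ->
  [/\ b11 * g 2 2 = g 0 0 * g 0 0 * a11 + g 0 0 * g 0 1 * a12
         + (g 0 1 * g 0 0 * a21 + g 0 1 * g 0 1 * a22),
      b12 * g 2 2 = g 0 0 * g 1 0 * a11 + g 0 0 * g 1 1 * a12
         + (g 0 1 * g 1 0 * a21 + g 0 1 * g 1 1 * a22),
      b21 * g 2 2 = g 1 0 * g 0 0 * a11 + g 1 0 * g 0 1 * a12
         + (g 1 1 * g 0 0 * a21 + g 1 1 * g 0 1 * a22) &
      b22 * g 2 2 = g 1 0 * g 1 0 * a11 + g 1 0 * g 1 1 * a12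
         + (g 1 1 * g 1 0 * a21 + g 1 1 * g 1 1 * a22)].
Proof.
move=> ge cg; have F i j pi pj := @conjugate_by_form _ _ _ g i j ge cg pi pj.
by split; [have := F 0 0 | have := F 0 1 | have := F 1 0 | have := F 1 1];
  rewrite !form_cochainE => /(_ erefl erefl).
Qed.

Lemma d13_scale (p q c c' : A) : c' * c = 1 -> equivalent (d13 (c * p) (c * q)) (d13 p q).
Proof.
move=> c1; rewrite !d13E.
apply: (@form_equivalent c' 0 0 1 1 c 1); first by transitivity (c' * c); first ring.
- by rewrite mulr1.
- by ring.
- by transitivity (c' * c * q); [rewrite c1; ring | ring].
- by transitivity (c' * c * p); [rewrite c1; ring | ring].
- by ring.
Qed.

Lemma d13_swap (p q : A) : equivalent (d13 p q) (d13 q p).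
Proof.
rewrite !d13E.
by apply: (@form_equivalent (-1) (p + q) 0 1 1 (-1) 1); ring.
Qed.

End Equivalences.

(** * Smooth and jump deformations *)

Section Families.
Variable K : numFieldType.
Implicit Types p q s t : K.

Lemma genericP p q : generic p q -> [/\ q != 0, p + q != 0 & p != q].
Proof.
move=> gen.
have q0 : q != 0.
  apply/eqP => q0; have [p0|p0] := eqVneq p 0.
    have [] := gen (0, 0); first by rewrite !inE eqxx !orbT.
    by case; exists 1; rewrite ?oner_neq0 // p0 q0 !mul1r.
  have [] := gen (1, 0); first by rewrite !inE eqxx.
  by case; exists p^-1; rewrite ?invr_eq0 //= q0 mulr0 mulVf.
split=> //; apply/eqP => pq.
  have {}pq : p = - q by apply/eqP; rewrite -addr_eq0 pq.
  have [] := gen (1, -1); first by rewrite !inE eqxx ?orbT.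
  case; exists p^-1; first by rewrite invr_eq0 pq oppr_eq0.
  by rewrite /= mulVf ?pq ?oppr_eq0 // invrN mulNr mulVf.
have [] := gen (1, 1); first by rewrite !inE eqxx ?orbT.
by case; exists p^-1; rewrite ?invr_eq0 pq //= mulVf.
Qed.

Lemma form_family (a11 a12 a21 a22 : {poly K}) d :
  d = form_cochain a11.[0] a12.[0] a21.[0] a22.[0] ->
  Defs.family d (fun s => form_cochain a11.[s] a12.[s] a21.[s] a22.[s]).
Proof.
move=> ->; split=> // [t|]; first exact: codifferential_form.
exists (form_cochain a11 a12 a21 a22) => t.
by rewrite (cochain_map_form (horner_eval t)).
Qed.

(** Comparing determinants ([E1]) and alternating parts ([E2]) and eliminating [D] and [k] gives the
    equation. Its factors mean [p' = p] and, in the other case, (p':q) = (q:p), the interchange of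
    coordinates. *)
Lemma d13_equivalent_eq p p' q : q != 0 -> equivalent (d13 p q) (d13 p' q) ->
  (p - p') * (q ^+ 2 - p * p') = 0.
Proof.
move=> q0; rewrite !d13E => -[g [ge cg]].
have [c' c1] := even_conj_unit ge cg.
have k0 : g 2 2 != 0.
  by apply/eqP => k0; move: c1; rewrite k0 mul0r => /eqP; rewrite eq_sym oner_eq0.
have [F00 F01 F10 F11] := conjugate_form_equations ge cg.
set k := g 2 2 in k0 F00 F01 F10 F11.
pose D := g 0 0 * g 1 1 - g 0 1 * g 1 0.
have E1 : q * p' * k ^+ 2 = D ^+ 2 * (q * p).
  transitivity ((q * k) * (p' * k) - (0 * k) * (1 * k)); first by ring.
  by rewrite F00 F01 F10 F11 /D; ring.
have E2 : (q - p') * k = D * (q - p).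
  transitivity (q * k - p' * k); first by ring.
  by rewrite F01 F10 /D; ring.
have : q * k ^+ 2 * ((p - p') * (q ^+ 2 - p * p')) = 0.
  transitivity (q * p * ((q - p') * k) ^+ 2 - q * p' * k ^+ 2 * (q - p) ^+ 2).
    by ring.
  by rewrite E1 E2; ring.
by move/eqP; rewrite mulf_eq0 mulf_eq0 (negPf q0) expf_eq0 (negPf k0) /= => /eqP.
Qed.

Lemma smooth_d13 p q : q != 0 -> p + q != 0 -> p != q ->
  smooth_deformation (d13 p q) (fun s => d13 (p + s) q).
Proof.
move=> q0 pq0 pq; split.
  have -> : (fun s => d13 (p + s) q) =
      (fun s => form_cochain (0 : {poly K}).[s] q%:P.[s] (p%:P + 'X).[s] (1 : {poly K}).[s]).
    by apply/funext => s; rewrite d13E !hornerE.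
  by apply: form_family; rewrite d13E !hornerE.
pose del := `|p ^+ 2 - q ^+ 2|.
have del0 : 0 < del by rewrite normr_gt0 subr_sqr mulf_neq0 // subr_eq0.
have M0 : 0 < 2 * `|p| + 1 by rewrite ltr_wpDl // mulr_ge0.
have N0 : 0 < 2 * `|p| + 1 + del by rewrite addr_gt0.
(* The second factor vanishes only if [del] is the modulus of p (s + t) + s t, which is at most (2
   |p| + 1) e when e <= 1. This choice gives e <= 1 and makes that bound smaller than [del]. *)
pose e := del / (2 * `|p| + 1 + del).
have e0 : 0 < e by rewrite divr_gt0.
have eM : (2 * `|p| + 1) * e < del.
  have -> : del = (2 * `|p| + 1) * e + del * e.
    by rewrite -mulrDl /e mulrCA mulfV ?mulr1 // gt_eqF.
  by rewrite ltrDl mulr_gt0.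
have e1 : e <= 1 by rewrite ler_pdivrMr // mul1r lerDr ltW.
exists e => // s t se te st /(d13_equivalent_eq q0)/eqP.
rewrite mulf_eq0 => /orP[|/eqP eq0].
  by rewrite opprD addrACA subrr add0r subr_eq0 (negPf st).
have : del < del; last by rewrite ltxx.
apply: le_lt_trans eM.
have -> : del = `|p * (s + t) + s * t|.
  by rewrite /del -normrN; congr `|_|; rewrite -[LHS]subr0 -eq0; ring.
apply: (le_trans (ler_normD _ _)); rewrite !normrM mulrDl mul1r; apply: lerD.
  have -> : 2 * `|p| * e = `|p| * (e + e) by ring.
  apply: ler_wpM2l => //; apply: (le_trans (ler_normD _ _)).
  by apply: lerD; apply: ltW.
rewrite -[leRHS]mul1r; apply: ler_pM => //; last exact: ltW.
by apply: le_trans e1; apply: ltW.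
Qed.

Lemma jump_plane1 :
  jump_deformation (d13 0 0) (fun s : K => d13_00_inf s 0 0 0) d12.
Proof.
have FE (s : K) : d13_00_inf s 0 0 0 = plane_cochain s 0 0 0.
  by rewrite d13_00_infE ?mulr0 ?mul0r.
have d12E : d12 = plane_cochain (-1) 0 0 0 :> cochain K by cochain_eq; ring.
split; last first.
  exists 1 => // t t0 _; rewrite FE d12E.
  apply: (@plane_equivalent _ (- t) 0 1 1 (- t^-1) 1); first 1 last.
  - by rewrite mulr1.
  - by rewrite mulr1.
  - by rewrite mulr0.
  - by ring.
  by rewrite mulr1 mulrNN mulVf.
split=> [|t|]; first by rewrite FE plane_cochain_form d13E.
  by rewrite FE; apply: codifferential_plane; rewrite ?mulr0 ?mul0r.
exists (plane_cochain 'X 0 0 0) => t.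
by rewrite (cochain_map_plane (horner_eval t)) FE /= /horner_eval !hornerE.
Qed.

Lemma jump_plane2 p q : exists f3 f4 : {poly K},
  jump_deformation (d13 0 0) (fun s => d13_00_inf 0 0 f3.[s] f4.[s]) (d13 p q).
Proof.
have h1 (x : K) : (1 : {poly K}).[x] = 1 by rewrite hornerE.
(* The shear of v_1 by - q v_2 makes a12 zero in [d13 p q], with a21 = p - q and a11 = - p q;
   scaling v_1 by [s] then gives the weights 1 and 2 of the two coefficients. *)
exists ((p - q) *: 'X), (- (p * q) *: 'X^2).
have FE (s : K) : d13_00_inf 0 0 ((p - q) *: 'X).[s] (- (p * q) *: 'X^2).[s] =
    form_cochain (- (p * q) * s ^+ 2) 0 ((p - q) * s) 1.
  by rewrite d13_00_infE ?mul0r // plane_cochain_form !hornerZ hornerX hornerXn.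
split; last first.
  exists 1 => // t t0 _; rewrite FE d13E.
  apply: (@form_equivalent _ t^-1 q 0 1 1 t 1).
  - by rewrite mulr0 subr0 mulr1 mulfV.
  - by rewrite mulr1.
  - transitivity (- (p * q) * (t^-1 * t) ^+ 2 + (q * (p - q) * (t^-1 * t) + q * q)).
      by rewrite mulVf //; ring.
    by ring.
  - by ring.
  - transitivity (t^-1 * t * (p - q) + q); first by rewrite mulVf //; ring.
    by ring.
  - by ring.
rewrite (_ : (fun s => _) = fun s => form_cochain (- (p * q) *: 'X^2).[s]
    (0 : {poly K}).[s] ((p - q) *: 'X).[s] (1 : {poly K}).[s]); last first.
  by apply/funext => s; rewrite FE !hornerZ hornerX hornerXn horner0 h1.
by apply: form_family; rewrite d13E !hornerZ hornerX hornerXn horner0 h1 expr0n !mulr0.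
Qed.

Lemma plane2_trivial (t3 t4 : K) :
  equivalent (d13_00_inf 0 0 t3 t4) (d13 0 0) -> t3 = 0 /\ t4 = 0.
Proof.
rewrite d13_00_infE ?mul0r // plane_cochain_form d13E => -[g [ge cg]].
have [h [gh hg _]] := cg.
have he := even_mx_inv ge gh hg; have ch := conjugate_by_sym gh hg cg.
have [c' c1] := even_conj_unit he ch.
have k0 : h 2 2 != 0.
  by apply/eqP => k0; move: c1; rewrite k0 mul0r => /eqP; rewrite eq_sym oner_eq0.
have [F00 F01 F10 F11] := conjugate_form_equations he ch.
rewrite !(mulr0, mul0r, add0r, mulr1, mul1r) in F00 F01 F10 F11.
have h11 : h 1 1 != 0 by apply: contraNneq k0; rewrite F11 => ->; rewrite mul0r.
have h01 : h 0 1 = 0.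
  by move/esym/eqP: F01; rewrite mulf_eq0 (negPf h11) orbF => /eqP.
rewrite h01 ?mulr0 ?mul0r in F00 F10.
by split; apply: (mulIf k0); rewrite ?F00 ?F10 ?mul0r.
Qed.

(** An even map only rescales v_3, so whether its square is zero is invariant, and in [d1] it is
    not. *)
Lemma plane1_e0 (t1 t2 : K) : equivalent (plane_cochain t1 t2 0 0) d1 -> t2 != 0.
Proof.
have -> : d1 = plane_cochain 0 (-1) 0 0 :> cochain K by cochain_eq; ring.
move=> [g [ge cg]]; apply/eqP => t20.
have [c' c1] := even_conj_unit ge cg.
have := conjugate_by_coef 2 2 2 cg.
rewrite !sum_ord3 !plane_cochainE t20 /= (ge 2 0) // (ge 2 1) // => e.
have k0 : g 2 2 = 0.
  transitivity (- (0 * g 0 2 + 0 * g 1 2 + -1 * g 2 2)); first by ring.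
  by rewrite e; ring.
by move: c1; rewrite k0 mul0r => /esym/eqP; rewrite oner_eq0.
Qed.

End Families.

Lemma plane1_equivalent (K : numClosedFieldType) (t1 t2 : K) :
  equivalent (d13_00_inf t1 t2 0 0) d1 <-> t2 != 0.
Proof.
rewrite d13_00_infE ?mulr0 //; split=> [|t20]; first exact: plane1_e0.
have -> : d1 = plane_cochain 0 (-1) 0 0 :> cochain K by cochain_eq; ring.
(* Turning [t2] into -1 requires [c = - t2^-1], and [c] must be the square of [s]. *)
pose s := sqrtC (- t2^-1).
have ss : s * s = - t2^-1 by rewrite -expr2 sqrtCK.
have s0 : s != 0 by rewrite sqrtC_eq0 oppr_eq0 invr_eq0.
apply: (@plane_equivalent _ 1 (s * t1 / t2) s (- t2^-1) s^-1 (- t2)); first 1 last.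
- by rewrite mulrNN mulfV.
- exact: ss.
- by rewrite mulNr mulVf.
- by ring.
by rewrite mul1r mulVf.
Qed.

Section Series.
Variable K : numFieldType.
Local Notation S := (pseries K 1).
Local Notation t := (psvar K (ord0 : 'I_1)).
Local Notation eps := (ps_aug K 1).
Local Notation cS := (pseries_complete K 1).

Lemma aug_t : eps t = 0.
Proof. exact: psvar_const. Qed.

Lemma coordinate_mul (z : S) : eps z != 0 -> coordinate (t * z).
Proof.
move=> z0; split; first by rewrite psvar_mulE mnm0E.
rewrite psvar_mulE mnm1E eqxx /=.
suff -> : (U_(ord0) - U_(ord0))%MM = 0%MM :> 'X_{1..1} by [].
by apply/mnmP => i; rewrite mnmBE subnn mnm0E.
Qed.

Lemma d13_10_deform (A : comNzRingType) (a : A) :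
  d13 1 0 + a *: psi 1 1 3 = form_cochain a 0 1 1.
Proof. by cochain_eq; ring. Qed.

Lemma d13_1N1_deform (A : comNzRingType) (a : A) :
  d13 1 (-1) + a *: psi 1 1 3 = form_cochain a (-1) 1 1.
Proof. by cochain_eq; ring. Qed.

Lemma d13_10_family : exists r : S,
  [/\ ps_const r = 1, r ^+ 2 = 1 - 4 * t,
      equivalent (d13 1 0 + t *: psi 1 1 3) (d13 (1 - 2 * t + r) (- 2 * t)) &
      exists2 w : S, coordinate w &
        equivalent (d13 1 0 + w *: psi 1 1 3) (d13 (1 + r) (2 * t))].
Proof.
have two0 : (2 : K) != 0 by rewrite pnatr_eq0.
have [|x mx xE] := @complete_quadratic _ _ eps cS 1 1 t _ aug_t.
  by rewrite rmorph1 oner_neq0.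
have tE : t = - (x + x ^+ 2).
  by apply/eqP; rewrite -addr_eq0 -[X in _ == X]xE; apply/eqP; ring.
have mx0 : eps x = 0 by [].
have e1 : eps (1 + (1 + 2 * x)) = 2.
  by rewrite !rmorphD rmorphM /= mx0 mulr0 addr0 rmorph1.
(* Since [x] is the root of x^2 + x + t = 0 in the kernel, this is the square root of the
   discriminant, and v_1 + x v_2 is isotropic. *)
exists (1 + 2 * x); split.
- by rewrite -[LHS]/(eps _) rmorphD rmorphM /= mx0 mulr0 addr0 rmorph1.
- by rewrite tE; ring.
- have [y yE _] := complete_inv_aug cS e1 two0.
  rewrite d13_10_deform d13E tE.
  apply: (@form_equivalent _ (1 + (1 + 2 * x)) ((1 + (1 + 2 * x)) * x) 0 1 1 y 1).
  + by rewrite mulr0 subr0 mulr1.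
  + by rewrite mulr1.
  + by ring.
  + by ring.
  + by ring.
  + by ring.
set r := 1 + 2 * x.
have e2 : eps (1 + r - 2 * t) = 2.
  by rewrite rmorphB rmorphM [X in X - _]e1 /= [X in _ * X]aug_t mulr0 subr0.
have [u uE eu] := complete_inv_aug cS e2 two0.
(* The target has determinant - 2t(1 + r) and alternating part of square (1 + r - 2t)^2; the source
   has determinant [w] and alternating part of square 1. So [w] is the invariant ratio of the
   target. *)
exists (t * (- (2 * u ^+ 2 * (1 + r)))).
  apply: coordinate_mul.
  have -> : eps (- (2 * u ^+ 2 * (1 + r))) = - (2 * (eps u * eps u) * eps (1 + r)).
    by rewrite rmorphN !rmorphM rmorph_nat.
  by rewrite eu [X in _ * X]e1 oppr_eq0 !mulf_neq0 ?invr_eq0.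
rewrite d13_10_deform d13E.
apply: (@form_equivalent _ (1 + r - 2 * t) (2 * t) 0 1 1 u 1).
- by rewrite mulr0 subr0 mulr1.
- by rewrite mulr1.
- transitivity (2 * t * (1 + r) * (1 - (u * (1 + r - 2 * t)) ^+ 2)).
    by rewrite uE; ring.
  by ring.
- by ring.
- by ring.
- by ring.
Qed.

Lemma form_equivalent_deformations (g11 g12 D a11 a12 a21 b11 b12 b21 : S) :
  D * g11 = 1 -> eps g11 = 1 -> eps g12 = 0 ->
  b11 = g11 * g11 * a11 + g11 * g12 * (a12 + a21) + g12 * g12 ->
  b12 = g11 * a12 + g12 -> b21 = g11 * a21 + g12 ->
  equivalent_deformations eps (form_cochain a11 a12 a21 1) (form_cochain b11 b12 b21 1).
Proof.
move=> D1 e11 e12 -> -> ->; apply/equivalent_deformationsP.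
exists (block_mx3 g11 g12 0 1 1); split; first exact: block_mx3_even.
  by apply: aug_block_mx3; rewrite ?rmorph0 ?rmorph1.
apply: (@form_conjugate _ g11 g12 0 1 1 D 1); try ring.
by rewrite mulr0 subr0 mulr1.
Qed.

(** The vector v_1 + t v_2 is isotropic, as t^2 is the opposite of a11 and a12 + a21 = 0; the
    scaling by 1 - t makes a21 equal to 1 - t^2. *)
Lemma d13_1N1_sqrt :
  equivalent_deformations eps (d13 1 (-1) + (- t ^+ 2) *: psi 1 1 3)
    (d13 (1 + (- t ^+ 2)) (-1 + (- t ^+ 2) + 2 * t)).
Proof.
have e1 : eps (1 - t) = 1 by rewrite rmorphB rmorph1 [X in _ - X]aug_t subr0.
have [y yE _] := complete_inv_aug cS e1 (oner_neq0 _).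
rewrite d13_1N1_deform d13E.
apply: (@form_equivalent_deformations (1 - t) ((1 - t) * t) y) => //; try ring.
by rewrite rmorphM [X in _ * X]aug_t mulr0.
Qed.

Lemma d13_1N1_sqrt_coordinate : exists2 w : S, coordinate w &
  equivalent_deformations eps (d13 1 (-1) + (- w ^+ 2) *: psi 1 1 3)
    (d13 (1 + (- t ^+ 2)) (-1 + (- t ^+ 2) + t)).
Proof.
have two0 : (2 : K) != 0 by rewrite pnatr_eq0.
pose hf : S := (2^-1)%:A.
have hfE : hf + hf = 1.
  have h2 : 2^-1 + 2^-1 = 1 :> K.
    by rewrite -[_ + _](mulr2n (2^-1 : K)) -(mulr_natl (2^-1 : K) 2) mulfV.
  by rewrite -scalerDl h2 scale1r.
have ehf : eps hf = 2^-1 by rewrite aug_scale.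
have e1 : eps (1 - t * hf) = 1.
  by rewrite rmorphB rmorph1 rmorphM [X in X * _]aug_t mul0r subr0.
have [y yE ey] := complete_inv_aug cS e1 (oner_neq0 _).
(* For a target (p:q) the invariant forces w^2 = ((p + q) / (p - q))^2; here p + q = t - 2 t^2 and p
   - q = 2 - t, both halved. *)
exists (t * ((hf - t) * y)).
  apply: coordinate_mul; rewrite rmorphM rmorphB /= [X in _ - X]aug_t subr0 [eps y]ey.
  by rewrite [X in X / _]ehf invr1 mulr1 invr_eq0.
rewrite d13_1N1_deform d13E.
apply: (@form_equivalent_deformations (1 - t * hf) (t * (hf - t)) y) => //.
- by rewrite rmorphM [X in X * _]aug_t mul0r.
- transitivity ((t * (hf - t)) ^+ 2 * (1 - (y * (1 - t * hf)) ^+ 2)).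
    by rewrite yE; ring.
  by ring.
- transitivity (- 1 - t ^+ 2 + t * (hf + hf)); last by ring.
  by rewrite hfE; ring.
by ring.
Qed.

End Series.

Lemma two_planes (K : numFieldType) : exists P P' : {vspace 'rV[K]_4},
  [/\ forall x, x \in P <-> x 0 2 = 0 /\ x 0 3 = 0,
      forall x, x \in P' <-> x 0 0 = 0 /\ x 0 1 = 0,
      forall x : 'rV[K]_4,
        (forall r, r \in d13_00_rels (x 0 0) (x 0 1) (x 0 2) (x 0 3) -> r = 0) <->
        x \in P \/ x \in P',
      \dim P = 2%N /\ \dim P' = 2%N &
      (P :&: P' = 0)%VS /\ (P + P' = fullv)%VS].
Proof.
pose e (i : 'I_4) : 'rV[K]_4 := delta_mx 0 i.
have sum4 (V : nmodType) (F : 'I_4 -> V) : \sum_i F i = F 0 + F 1 + F 2 + F 3.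
  rewrite !big_ord_recl big_ord0 addr0 !addrA.
  by congr (_ + F _ + F _ + F _); apply: val_inj.
have rowE (x : 'rV[K]_4) : x = x 0 0 *: e 0 + x 0 1 *: e 1 + x 0 2 *: e 2 + x 0 3 *: e 3.
  by rewrite {1}[x]row_sum_delta sum4.
pose P := (<[e 0%R]> + <[e 1%R]>)%VS; pose P' := (<[e 2%R]> + <[e 3%R]>)%VS.
have PE x : x \in P <-> x 0 2 = 0 /\ x 0 3 = 0.
  split=> [/memv_addP[_ /vlineP[a ->] [_ /vlineP[b ->] ->]]|[x2 x3]].
    by rewrite !mxE /= !mulr0 addr0.
  by rewrite [x]rowE x2 x3 !scale0r !addr0 memv_add // memvZ // memv_line.
have P'E x : x \in P' <-> x 0 0 = 0 /\ x 0 1 = 0.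
  split=> [/memv_addP[_ /vlineP[a ->] [_ /vlineP[b ->] ->]]|[x2 x3]].
    by rewrite !mxE /= !mulr0 addr0.
  by rewrite [x]rowE x2 x3 !scale0r !add0r memv_add // memvZ // memv_line.
have PP' : (P :&: P' = 0)%VS.
  apply/eqP; rewrite -subv0; apply/subvP => x; rewrite memv_cap memv0.
  move=> /andP[/PE[x2 x3] /P'E[x0 x1]].
  by rewrite [x]rowE x0 x1 x2 x3 !scale0r !addr0.
have sPP' : (P + P' = fullv)%VS.
  apply/vspaceP => x; rewrite memvf.
  rewrite [x]rowE -addrA; apply: memv_add; apply/memv_add; exact/memvZ/memv_line.
exists P, P'; split=> //.
  move=> x; split=> [r0|].
    have z y : y \in [:: x 0 0 * x 0 2; x 0 0 * x 0 3; x 0 1 * x 0 2; x 0 1 * x 0 3] -> y = 0.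
      move=> /(@d13_00_ideal_gens _ (x 0 0) (x 0 1) (x 0 2) (x 0 3)) /asboolP[c ->].
      rewrite big1 // => i _.
      by rewrite (r0 _ (mem_nth 0 (ltn_ord i))) mulr0.
    have z02 : x 0 0 * x 0 2 = 0 by apply: z; rewrite !inE eqxx ?orbT.
    have z03 : x 0 0 * x 0 3 = 0 by apply: z; rewrite !inE eqxx ?orbT.
    have z12 : x 0 1 * x 0 2 = 0 by apply: z; rewrite !inE eqxx ?orbT.
    have z13 : x 0 1 * x 0 3 = 0 by apply: z; rewrite !inE eqxx ?orbT.
    have [x0|x0] := eqVneq (x 0 0) 0; last first.
      left; apply/PE; split; apply: (mulfI x0); by rewrite mulr0.
    have [x1|x1] := eqVneq (x 0 1) 0; last first.
      left; apply/PE; split; apply: (mulfI x1); by rewrite mulr0.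
    by right; apply/P'E.
  by case=> [/PE|/P'E] [y1 y2]; apply: d13_00_rels_eq0; rewrite ?y1 ?y2 ?mulr0 ?mul0r.
have dim2 (u v : 'rV[K]_4) : (\dim (<[u]> + <[v]>)%VS <= 2)%N.
  apply: leq_trans (dimv_add_leqif _ _) _.
  by apply: (leq_add (n1 := 1) (n2 := 1)); rewrite dim_vline leq_b1.
(* The dimensions are at most 2 and add up to 4, so both are 2. *)
have := dimv_sum_cap P P'; rewrite PP' sPP' dimv0 addn0 dimvf /dim /= mul1n.
have := dim2 (e 0) (e 1); have := dim2 (e 2) (e 3); rewrite -/P -/P'.
by case: (\dim P) => [|[|[|]]] //; case: (\dim P') => [|[|[|]]].
Qed.

Theorem mainTheorem5 (R : realType) :
  let C : numClosedFieldType := R[i] in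
  let aug : {lrmorphism pseries C 1 -> C | *%R} := ps_aug C 1 in
  let t : pseries C 1 := psvar C ord0 in
  (* dependence of d13(p : q) on (p : q) *)
  ((forall p q c : C, c != 0 -> equivalent (d13 (c * p) (c * q)) (d13 p q)) /\
   (forall p q : C, equivalent (d13 p q) (d13 q p))) /\
  (* (i) *)
  ((forall p q : C, generic p q ->
      miniversal (d13 p q) aug (d13 (p%:A + t) q%:A) /\
      smooth_deformation (d13 p q) (fun s => d13 (p + s) q)) /\
   miniversal (d13 1 1) aug (d13 (1 + t) 1)) /\
  (* (ii); r is the square root of 1 - 4t *)
  (miniversal (d13 1 0) aug (d13 1 0 + t *: psi 1 1 3) /\
   (exists r : pseries C 1,
     [/\ ps_const r = 1, r ^+ 2 = 1 - 4 * t,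
         equivalent (d13 1 0 + t *: psi 1 1 3)
                    (d13 (1 - 2 * t + r) (- 2 * t)) &
         exists2 w : pseries C 1, coordinate w &
           equivalent (d13 1 0 + w *: psi 1 1 3) (d13 (1 + r) (2 * t))])) /\
  (* (iii); u is the square root of - t, so that t = - u ^+ 2 in C[[u]] *)
  (miniversal (d13 1 (-1)) aug (d13 1 (-1) + t *: psi 1 1 3) /\
   (let u := t in
    equivalent_deformations aug
      (d13 1 (-1) + (- u ^+ 2) *: psi 1 1 3)
      (d13 (1 + (- u ^+ 2)) (-1 + (- u ^+ 2) + 2 * u)) /\
    exists2 w : pseries C 1, coordinate w &
      equivalent_deformations aug
        (d13 1 (-1) + (- w ^+ 2) *: psi 1 1 3)
        (d13 (1 + (- u ^+ 2)) (-1 + (- u ^+ 2) + u)))) /\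
  (* (iv): the miniversal deformation *)
  (d13 0 0 = psi 2 2 3 :> cochain C /\
   miniversal (d13 0 0) (d13_00_eps C)
     (d13_00_inf (d13_00_var C 0) (d13_00_var C 1)
                 (d13_00_var C 2) (d13_00_var C 3))) /\
  (* (iv): the base as two planes intersecting transversally *)
  ((exists P P' : {vspace 'rV[C]_4},
     [/\ forall x, x \in P <-> x 0 2 = 0 /\ x 0 3 = 0,
         forall x, x \in P' <-> x 0 0 = 0 /\ x 0 1 = 0,
         forall x : 'rV[C]_4,
           (forall r, r \in d13_00_rels (x 0 0) (x 0 1) (x 0 2) (x 0 3) ->
             r = 0) <-> x \in P \/ x \in P',
         \dim P = 2%N /\ \dim P' = 2%N &
         (P :&: P' = 0)%VS /\ (P + P' = fullv)%VS]) /\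
   (forall f : pseries C 4, f \in d13_00_ideal C <->
      f \in ideal_gen [:: psvar C 2; psvar C 3] /\
      f \in ideal_gen [:: psvar C 0; psvar C 1])) /\
  (* (iv): the first plane *)
  ((forall t1 t2 : C, d13_00_inf t1 t2 0 0 =
      psi 2 2 3 + t1 *: (psi 3 2 1 - psi 2 3 1)
                + t2 *: (psi 3 2 2 - psi 2 3 2 + psi 3 3 3)) /\
   (forall t1 t2 : C, equivalent (d13_00_inf t1 t2 0 0) d1 <-> t2 != 0) /\
   jump_deformation (d13 0 0) (fun s : C => d13_00_inf s 0 0 0) d12) /\
  (* (iv): the second plane *)
  ((forall t3 t4 : C, d13_00_inf 0 0 t3 t4 =
      psi 2 2 3 + t3 *: psi 2 1 3 + t4 *: psi 1 1 3) /\
   (forall p q : C, (p, q) != (0, 0) ->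
      exists f3 f4 : {poly C},
        jump_deformation (d13 0 0) (fun s => d13_00_inf 0 0 f3.[s] f4.[s])
          (d13 p q)) /\
   (forall t3 t4 : C, equivalent (d13_00_inf 0 0 t3 t4) (d13 0 0) ->
      t3 = 0 /\ t4 = 0)).
Proof.
move=> C aug t.
have two0 : (2 : C) != 0 by rewrite pnatr_eq0.
split.
  split=> [p q c c0|p q]; last exact: d13_swap.
  exact: (d13_scale p q (mulVf c0)).
split.
  split=> [p q /genericP[q0 pq0 pq]|].
    by split; [exact: miniversal_d13 | exact: smooth_d13].
  (* At (1:1) the miniversality argument still applies, since q = 1 and p + q = 2 are nonzero; the
     smoothness argument, which uses p != q, does not. *)
  have := @miniversal_d13 C 1 1 (oner_neq0 _) two0.
  by rewrite scale1r.
split; first by split; [exact: miniversal_d13_10 | exact: d13_10_family].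
split.
  split; first exact: miniversal_d13_1N1.
  by split; [exact: d13_1N1_sqrt | exact: d13_1N1_sqrt_coordinate].
split.
  by split; [rewrite /d13 !scale0r !addr0 | exact: miniversal_d13_00].
split; first by split; [exact: two_planes | exact: d13_00_idealP].
split.
  split; first exact: d13_00_inf_plane1.
  by split; [exact: plane1_equivalent | exact: jump_plane1].
split; first exact: d13_00_inf_plane2.
by split=> [p q _|]; [exact: jump_plane2 | exact: plane2_trivial].
Qed.
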